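(* Consider the case without line thermal limits, as described in the context, and assume Assumptions 1 and 2 hold. Then for the DPPD dynamics (without line limits): 1) if $d(0)\in\Omega$, then $d_i(t)\in\Omega_i$ for all $i\in\mathcal N$ and all $t\ge0$; 2) every trajectory $(\eta,d,\hat\theta,P,\omega,\mu)$ is bounded; 3) every trajectory $(\eta,d,\hat\theta,P,\omega,\mu)$ converges globally and asymptotically to an equilibrium point $(\eta^*,d^*,\hat\theta^*,P^*,\omega^*,\mu^* )$ of the dynamics, where $(d^*,\hat\theta^*,P^*,\omega^* )$ is an optimal solution of the ROLC problem (without line limits).
   Context: Power network: a directed connected graph $\mathcal G(\mathcal N,\mathcal E)$ with buses $\mathcal N=\{1,\dots,n\}$ and lines $\mathcal E\subseteq\mathcal N\times\mathcal N$. Each line $ij$ has susceptance $B_{ij}>0$; each bus has damping $D_i>0$ and a given constant power injection $P_i^{in}\in\mathbb R$. For $x\in\mathbb R^n$ write $x_{ij}=x_i-x_j$. Costs: $f_i=f_{i,0}+f_{i,1}+f_{i,2}$, where $f_{i,0}:\mathbb R\to\mathbb R$ is differentiable, $f_{i,1}$ is the indicator function of $\Omega_i=[\underline d_i,\overline d_i]$ ($0$ on $\Omega_i$, $+\infty$ outside), and $f_{i,2}:\mathbb R\to\mathbb R$ is lower semicontinuous convex; $\Omega=\Omega_1\times\dots\times\Omega_n$. Assumption 1: each $f_{i,0}$ is $\beta$-strongly convex with $\beta>1$. Assumption 2 (Slater): there exist $\tilde d\in\mathrm{relint}(\Omega)$ and $\tilde\theta\in\mathbb R^n$ with $0=P_i^{in}-\tilde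 d_i+\sum_{k:ki\in\mathcal E}B_{ki}\tilde\theta_{ki}-\sum_{j:ij\in\mathcal E}B_{ij}\tilde\theta_{ij}$ for all $i$ and $\underline P_{ij}<B_{ij}\tilde\theta_{ij}<\overline P_{ij}$ for all $ij\in\mathcal E$ (for given line limits $\underline P_{ij}\le\overline P_{ij}$). ROLC problem without line limits: minimize over $d,\hat\theta,\omega\in\mathbb R^n$, $P=(P_{ij})_{ij\in\mathcal E}$ the function $\sum_i\big(f_i(d_i)+\tfrac{D_i}{2}\omega_i^2\big)$ subject to, for all $i\in\mathcal N$, $0=P_i^{in}-D_i\omega_i-d_i+\sum_{k:ki\in\mathcal E}P_{ki}-\sum_{j:ij\in\mathcal E}P_{ij}$ and $0=P_i^{in}-d_i+\sum_{k:ki\in\mathcal E}B_{ki}\hat\theta_{ki}-\sum_{j:ij\in\mathcal E}B_{ij}\hat\theta_{ij}$. Proximal operator: $\mathbf{prox}_{g}(y)=\arg\min_x\{g(x)+\tfrac12\|x-y\|^2\}$. DPPD dynamics without line limits (fixed constant $\kappa\in(0,1)$): with $u_{i,1}=P_i^{in}-d_i-D_i\omega_i+\sum_{k:ki\in\mathcal E}P_{ki}-\sum_{j:ij\in\mathcal E}P_{ij}$ and $u_{i,2}=P_i^{in}-d_i+\sum_{k:ki\in\mathcal E}B_{ki}\hat\theta_{ki}-\sum_{j:ij\in\mathcal E}B_{ij}\hat\theta_{ij}$: $\dot\eta_i=\mathbf{prox}_{f_{i,2}}(d_i-\kappa\eta_i)-d_i$; $\dot d_i=\mathbf{prox}_{f_{i,1}}\big(d_i-\nabla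 f_{i,0}(d_i)+\kappa\eta_i+\lambda_i+u_{i,1}+\mu_i+u_{i,2}\big)-d_i$; $\omega_i=\lambda_i$; $\dot{\hat\theta}_i=\sum_{j:ij\in\mathcal E}B_{ij}(\mu_i+u_{i,2}-\mu_j-u_{j,2})-\sum_{k:ki\in\mathcal E}B_{ki}(\mu_k+u_{k,2}-\mu_i-u_{i,2})$; $\dot P_{ij}=\lambda_i+u_{i,1}-\lambda_j-u_{j,1}$; $\dot\lambda_i=\tfrac12u_{i,1}$; $\dot\mu_i=\tfrac12u_{i,2}$. An equilibrium point is a point at which all these right-hand sides vanish. *)

(* Defs.v *)
From HB Require Import structures.
From mathcomp Require Import all_boot all_order all_algebra.
From mathcomp Require Import all_classical all_reals all_analysis.
Set Implicit Arguments. Unset Strict Implicit. Unset Printing Implicit Defensive.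
Import Order.TTheory GRing.Theory Num.Theory.
Import numFieldNormedType.Exports.
Local Open Scope classical_set_scope.
Local Open Scope ring_scope.

Definition convex_on_R {R : realType} (f : R -> R) :=
  forall x y t : R, 0 <= t <= 1 ->
    f (t * x + (1 - t) * y) <= t * f x + (1 - t) * f y.

Definition strongly_convex {R : realType} (beta : R) (f : R -> R) :=
  forall x y t : R, 0 <= t <= 1 ->
    f (t * x + (1 - t) * y) <=
      t * f x + (1 - t) * f y - beta / 2 * t * (1 - t) * (x - y) ^+ 2.

Definition indicator_itv {R : realType} (lo hi : R) (x : R) : \bar R :=
  if (lo <= x) && (x <= hi) then 0%E else +oo%E.

(* prox_g(y) = argmin_x { g x + 1/2 |x - y|^2 } for an extended-valued g;
   the minimizer is required to lie in the effective domain of g.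
   (xget picks the minimizer; it is unique in all uses below.) *)
Definition prox {R : realType} (g : R -> \bar R) (y : R) : R :=
  xget 0 [set x | (g x < +oo)%E /\
     forall z, (g x + ((x - y) ^+ 2 / 2)%:E <= g z + ((z - y) ^+ 2 / 2)%:E)%E].

Definition weakly_connected {n : nat} (E : rel 'I_n) :=
  forall i j : 'I_n, connect (fun a b => E a b || E b a) i j.

Definition u1 {R : realType} {n : nat} (E : rel 'I_n) (Pin D : 'I_n -> R)
  (d w : 'I_n -> R) (P : 'I_n -> 'I_n -> R) (i : 'I_n) : R :=
  Pin i - d i - D i * w i + (\sum_(k < n | E k i) P k i)
    - (\sum_(j < n | E i j) P i j).

Definition u2 {R : realType} {n : nat} (E : rel 'I_n) (B : 'I_n -> 'I_n -> R)
  (Pin : 'I_n -> R) (d th : 'I_n -> R) (i : 'I_n) : R :=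
  Pin i - d i + (\sum_(k < n | E k i) B k i * (th k - th i))
    - (\sum_(j < n | E i j) B i j * (th i - th j)).

(* total cost (extended-valued, f_{i,1} is the indicator of Omega_i) *)
Definition rolc_cost {R : realType} {n : nat} (f0 f2 : 'I_n -> R -> R)
  (lo hi D : 'I_n -> R) (d w : 'I_n -> R) : \bar R :=
  (\sum_(i < n) ((f0 i (d i))%:E + indicator_itv (lo i) (hi i) (d i)
                 + (f2 i (d i))%:E + (D i / 2 * w i ^+ 2)%:E))%E.

Definition rolc_feasible {R : realType} {n : nat} (E : rel 'I_n)
  (B : 'I_n -> 'I_n -> R) (Pin D : 'I_n -> R)
  (d th w : 'I_n -> R) (P : 'I_n -> 'I_n -> R) :=
  forall i, u1 E Pin D d w P i = 0 /\ u2 E B Pin d th i = 0.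

Definition rolc_optimal {R : realType} {n : nat} (E : rel 'I_n)
  (B : 'I_n -> 'I_n -> R) (Pin D lo hi : 'I_n -> R) (f0 f2 : 'I_n -> R -> R)
  (d th w : 'I_n -> R) (P : 'I_n -> 'I_n -> R) :=
  rolc_feasible E B Pin D d th w P /\
  (rolc_cost f0 f2 lo hi D d w < +oo)%E /\
  forall d' th' w' P', rolc_feasible E B Pin D d' th' w' P' ->
    (rolc_cost f0 f2 lo hi D d w <= rolc_cost f0 f2 lo hi D d' w')%E.

(* right-hand sides, evaluated at a state (eta, d, th, P, lam, mu), omega = lam *)
Definition rhs_eta {R : realType} {n : nat} (f2 : 'I_n -> R -> R) (kappa : R)
  (eta d : 'I_n -> R) (i : 'I_n) : R :=
  prox (fun x => (f2 i x)%:E) (d i - kappa * eta i) - d i.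

Definition rhs_d {R : realType} {n : nat} (E : rel 'I_n) (B : 'I_n -> 'I_n -> R)
  (Pin D lo hi : 'I_n -> R) (f0 : 'I_n -> R -> R) (kappa : R)
  (eta d th : 'I_n -> R) (P : 'I_n -> 'I_n -> R) (lam mu : 'I_n -> R)
  (i : 'I_n) : R :=
  prox (indicator_itv (lo i) (hi i))
    (d i - derive1 (f0 i) (d i) + kappa * eta i + lam i + u1 E Pin D d lam P i
       + mu i + u2 E B Pin d th i) - d i.

Definition rhs_th {R : realType} {n : nat} (E : rel 'I_n) (B : 'I_n -> 'I_n -> R)
  (Pin : 'I_n -> R) (d th mu : 'I_n -> R) (i : 'I_n) : R :=
  (\sum_(j < n | E i j) B i j * (mu i + u2 E B Pin d th i - mu j - u2 E B Pin d th j))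
  - (\sum_(k < n | E k i) B k i * (mu k + u2 E B Pin d th k - mu i - u2 E B Pin d th i)).

Definition rhs_P {R : realType} {n : nat} (E : rel 'I_n) (Pin D : 'I_n -> R)
  (d : 'I_n -> R) (P : 'I_n -> 'I_n -> R) (lam : 'I_n -> R) (i j : 'I_n) : R :=
  lam i + u1 E Pin D d lam P i - lam j - u1 E Pin D d lam P j.

Definition rhs_lam {R : realType} {n : nat} (E : rel 'I_n) (Pin D : 'I_n -> R)
  (d : 'I_n -> R) (P : 'I_n -> 'I_n -> R) (lam : 'I_n -> R) (i : 'I_n) : R :=
  u1 E Pin D d lam P i / 2.

Definition rhs_mu {R : realType} {n : nat} (E : rel 'I_n) (B : 'I_n -> 'I_n -> R)
  (Pin : 'I_n -> R) (d th : 'I_n -> R) (i : 'I_n) : R :=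
  u2 E B Pin d th i / 2.

(* equilibrium point: all right-hand sides vanish (omega^* = lambda^* ) *)
Definition dppd_equilibrium {R : realType} {n : nat} (E : rel 'I_n)
  (B : 'I_n -> 'I_n -> R) (Pin D lo hi : 'I_n -> R) (f0 f2 : 'I_n -> R -> R)
  (kappa : R) (eta d th : 'I_n -> R) (P : 'I_n -> 'I_n -> R)
  (lam mu : 'I_n -> R) :=
  (forall i, rhs_eta f2 kappa eta d i = 0) /\
  (forall i, rhs_d E B Pin D lo hi f0 kappa eta d th P lam mu i = 0) /\
  (forall i, rhs_th E B Pin d th mu i = 0) /\
  (forall i j, E i j -> rhs_P E Pin D d P lam i j = 0) /\
  (forall i, rhs_lam E Pin D d P lam i = 0) /\
  (forall i, rhs_mu E B Pin d th i = 0).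

Definition dppd_trajectory {R : realType} {n : nat} (E : rel 'I_n)
  (B : 'I_n -> 'I_n -> R) (Pin D lo hi : 'I_n -> R) (f0 f2 : 'I_n -> R -> R)
  (kappa : R) (eta d th : 'I_n -> R -> R) (P : 'I_n -> 'I_n -> R -> R)
  (w lam mu : 'I_n -> R -> R) :=
  let at_ (x : 'I_n -> R -> R) t := fun i => x i t in
  let atP t := fun i j => P i j t in
  (forall i t, w i t = lam i t) /\
  (forall i, {within `[0, +oo[%classic, continuous (eta i)}) /\
  (forall i, {within `[0, +oo[%classic, continuous (d i)}) /\
  (forall i, {within `[0, +oo[%classic, continuous (th i)}) /\
  (forall i j, E i j -> {within `[0, +oo[%classic, continuous (P i j)}) /\
  (forall i, {within `[0, +oo[%classic, continuous (lam i)}) /\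
  (forall i, {within `[0, +oo[%classic, continuous (mu i)}) /\
  forall t : R, 0 < t ->
    (forall i, is_derive t 1 (eta i) (rhs_eta f2 kappa (at_ eta t) (at_ d t) i)) /\
    (forall i, is_derive t 1 (d i)
        (rhs_d E B Pin D lo hi f0 kappa (at_ eta t) (at_ d t) (at_ th t)
           (atP t) (at_ lam t) (at_ mu t) i)) /\
    (forall i, is_derive t 1 (th i)
        (rhs_th E B Pin (at_ d t) (at_ th t) (at_ mu t) i)) /\
    (forall i j, E i j -> is_derive t 1 (P i j)
        (rhs_P E Pin D (at_ d t) (atP t) (at_ lam t) i j)) /\
    (forall i, is_derive t 1 (lam i)
        (rhs_lam E Pin D (at_ d t) (atP t) (at_ lam t) i)) /\
    (forall i, is_derive t 1 (mu i)
        (rhs_mu E B Pin (at_ d t) (at_ th t) i)).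

Definition bounded_fwd {R : realType} (x : R -> R) :=
  exists M : R, forall t, 0 <= t -> `|x t| <= M.

(* relative interior of the interval [lo, hi] (empty if lo > hi, {lo} if lo = hi) *)
Definition in_relint_itv {R : realType} (lo hi x : R) :=
  (lo < x < hi) \/ (lo = x /\ x = hi).

(* Main.v *)
Require Import Defs.
From HB Require Import structures.
From mathcomp Require Import all_boot all_order all_algebra.
From mathcomp Require Import all_classical all_reals all_analysis.
From mathcomp Require Import ring lra.
Set Implicit Arguments. Unset Strict Implicit. Unset Printing Implicit Defensive.
Import Order.TTheory GRing.Theory Num.Theory.
Import numFieldNormedType.Exports.
Local Open Scope classical_set_scope.
Local Open Scope ring_scope.

(** Write [x~ = x - x0] for the deviation from an equilibrium [x0], where [lam] vanishes.
    The sum over buses of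
      [d~^2/2 + Breg_f0 (d, d0) + kappa/2 eta~^2 - kappa eta~ d~
       + (mu~ + u2)^2/2 + mu~^2/2 + th~^2/2 + (lam + u1)^2/2 + lam^2/2 + 3/2 D lam^2],
    plus the sum over lines of [P~^2/2], is a Lyapunov function [V]: it is
    coercive and, since the proximal maps turn subdifferentials of the costs into
    monotone relations, it decreases along trajectories at rate at least
    [c |vector field|^2] for some [c > 0]; the cross term [- kappa eta~ d~] is what
    couples the two proximal steps. So trajectories are bounded, and the vector
    field is arbitrarily small at arbitrarily late times. A limit point of the
    trajectory along such times is an equilibrium; [V] centred at that equilibrium
    is nonincreasing and comes arbitrarily close to 0, hence tends to 0.

    An equilibrium exists: the minimizers of [f0 i + f2 i - m x] on [[lo i, hi i]]
    depend continuously on the common price [m], the intermediate value theorem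
    balances the total load, and the Laplacian of a connected graph maps onto the
    vectors of zero sum. *)

(** * Real analysis *)

Lemma ler_mul_sqr {R : realDomainType} (a b : R) : a <= b -> forall r, a * r ^+ 2 <= b * r ^+ 2.
Proof. by move=> ab r; rewrite ler_wpM2r ?sqr_ge0. Qed.

Lemma cvg_sqr_dominated {R : realType} {T : Type} (F : set_system T) (FF : Filter F)
    (f v : T -> R) (l : R) :
  (\forall t \near F, (f t - l) ^+ 2 <= v t) ->
  v t @[t --> F] --> 0 -> f t @[t --> F] --> l.
Proof.
move=> fv v0; apply/cvgrPdist_le => e e0.
have e2 : 0 < e ^+ 2 by rewrite exprn_gt0.
near=> t; rewrite distrC -ler_sqr ?nnegrE ?(ltW e0) // real_normK ?num_real //.
have : (f t - l) ^+ 2 <= v t by near: t.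
by move=> /le_trans; apply; apply: ltW; near: t; exact: (cvgr_lt _ v0).
Unshelve. all: by end_near. Qed.

Lemma cvg_sqr {R : realType} {T : Type} (F : set_system T) (FF : Filter F)
    (f : T -> R) (l : R) : f t @[t --> F] --> l -> f t ^+ 2 @[t --> F] --> l ^+ 2.
Proof. by move=> fl; exact: cvgM. Qed.

Lemma cvg_bigsum {R : realType} {I T : Type} (F : set_system T) (FF : Filter F)
    (r : seq I) (Q : pred I) (f : I -> T -> R) (l : I -> R) :
  (forall i, Q i -> f i t @[t --> F] --> l i) ->
  \sum_(i <- r | Q i) f i t @[t --> F] --> \sum_(i <- r | Q i) l i.
Proof. by move=> fl; apply: cvg_big => //; exact: add_continuous. Qed.

Lemma is_derive_bigsum {R : realType} {I : Type} (r : seq I) (Q : pred I)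
    (f : I -> R -> R) (df : I -> R) (t : R) :
  (forall i, Q i -> is_derive t 1 (f i) (df i)) ->
  is_derive t 1 (fun s => \sum_(i <- r | Q i) f i s) (\sum_(i <- r | Q i) df i).
Proof.
move=> dft; elim: r => [|i r IH].
  by under eq_fun do rewrite big_nil; rewrite big_nil; exact: is_derive_cst.
rewrite big_cons; under eq_fun do rewrite big_cons.
by case: ifP => // /dft ?; exact: is_deriveD.
Qed.

Lemma derivable1_continuous {R : realType} (f : R -> R) :
  (forall x, derivable f x 1) -> continuous f.
Proof. by move=> df x; apply/differentiable_continuous/derivable1_diffP. Qed.

Lemma locally_lipschitz_continuous {R : realType} (f : R -> R) (x k : R) :
  (\forall y \near x, `|f y - f x| <= k * `|y - x|) -> {for x, continuous f}.
Proof.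
move=> lip; apply/subr_cvg0/norm_cvg0P.
apply: (squeeze_cvgr (f := fun=> 0) (h := fun y => k * `|y - x|)).
- by apply: filterS lip => y ->; rewrite normr_ge0.
- exact: cvg_cst.
- rewrite [X in _ --> X](_ : 0 = k * `|x - x|); last by rewrite subrr normr0 mulr0.
  apply: cvgM; first exact: cvg_cst.
  by apply: cvg_norm; apply: cvgB; [exact: cvg_id|exact: cvg_cst].
Qed.

Lemma cvg_right_slope {R : realType} (f : R -> R) (x v : R) : derivable f x 1 ->
  (f (x + t * v) - f x) / t @[t --> 0^'+] --> derive1 f x * v.
Proof.
move=> df; have dfv : is_derive (0 : R) 1 (f \o (fun t => x + t * v)) (derive1 f x * v).
  apply: is_derive1_comp; last by apply: is_derive_eq; rewrite /GRing.scale /=; ring.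
  by rewrite mul0r addr0 derive1E; exact: derivableP.
have /cvg_ex[l slope] := @ex_derive _ _ _ _ _ _ _ dfv.
have lE : l = derive1 f x * v.
  have := @derive_val _ _ _ _ _ _ _ dfv; rewrite /derive => <-.
  by rewrite (cvg_lim _ slope).
move/cvg_dnbhs_at_right : slope; rewrite lE; apply: cvg_trans.
apply: near_eq_cvg; near=> t; rewrite /= /GRing.scale /= mulr1 addr0 mul0r addr0.
by rewrite mulrC.
Unshelve. all: by end_near. Qed.

Lemma derive1_le_increment {R : realType} (f : R -> R) (s t a : R) : s <= t ->
  (forall r, s <= r <= t -> derivable f r 1) ->
  (forall r, s <= r <= t -> derive1 f r <= a) -> f t - f s <= a * (t - s).
Proof.
move=> st df dfa; have [||r rst ->] := @MVT_segment R f (derive1 f) s t st.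
- move=> r; rewrite in_itv /= => /andP[/ltW sr /ltW rt].
  by rewrite derive1E; apply: derivableP; apply: df; rewrite sr.
- apply: derivable_within_continuous => r; rewrite in_itv /=; exact: df.
- by rewrite ler_wpM2r ?subr_ge0 // dfa // -in_itv.
Qed.

(** * Convex functions of one real variable *)

Section convex_functions.
Context {R : realType}.
Implicit Types (f g : R -> R) (x y z : R).

Lemma strongly_convex_tangent (beta : R) f x y :
  strongly_convex beta f -> derivable f x 1 ->
  f x + derive1 f x * (y - x) + beta / 2 * (y - x) ^+ 2 <= f y.
Proof.
move=> scf df; suff : derive1 f x * (y - x) <= f y - f x - beta / 2 * (y - x) ^+ 2 by lra.
pose b := beta / 2 * (y - x) ^+ 2.
have lim : f y - f x - b + t * b @[t --> 0^'+] --> f y - f x - b.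
  rewrite [X in _ --> X](_ : _ = f y - f x - b + 0 * b); last by rewrite mul0r addr0.
  apply: cvgD; first exact: cvg_cst.
  by apply: cvgM; [apply: cvg_at_right_filter; exact: cvg_id|exact: cvg_cst].
apply: (ler_cvg_to (cvg_right_slope df) lim).
near=> t; have t0 : 0 < t by near: t; exact: nbhs_right_gt.
have t1 : t <= 1 by near: t; exact: nbhs_right_le.
rewrite ler_pdivrMr //; have := scf y x t; rewrite (ltW t0) t1 => /(_ isT).
have -> : t * y + (1 - t) * x = x + t * (y - x) by ring.
by rewrite /b; nra.
Unshelve. all: by end_near. Qed.

Lemma strongly_convex_monotone (beta : R) f x y :
  strongly_convex beta f -> derivable f x 1 -> derivable f y 1 ->
  beta * (x - y) ^+ 2 <= (derive1 f x - derive1 f y) * (x - y).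
Proof.
move=> scf dfx dfy.
have := strongly_convex_tangent y scf dfx; have := strongly_convex_tangent x scf dfy.
by nra.
Qed.

Lemma tangent_derive1_continuous f :
  (forall x, derivable f x 1) ->
  (forall x y, f x + derive1 f x * (y - x) <= f y) -> continuous (derive1 f).
Proof.
move=> df tangent x.
have upper v e : 0 < e -> \forall y \near x, derive1 f y * v < derive1 f x * v + e.
  move=> e0; have dve : derive1 f x * v < derive1 f x * v + e by rewrite ltrDl.
  have [t [t0 slope_lt]] := @filter_ex _ (0 : R)^'+ _ _
    (filterI (nbhs_right_gt 0) (cvgr_lt _ (cvg_right_slope (df x)) _ dve)).
  have slopec : (f (y + t * v) - f y) / t @[y --> x] --> (f (x + t * v) - f x) / t.
    apply: cvgM; last exact: cvg_cst.
    apply: cvgB; last exact: derivable1_continuous.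
    apply: (@continuous_comp _ _ _ (fun y => y + t * v) f); last exact: derivable1_continuous.
    by apply: cvgD; [exact: cvg_id|exact: cvg_cst].
  apply: filterS (cvgr_lt _ slopec _ slope_lt) => y; apply: le_lt_trans.
  by rewrite ler_pdivlMr //; have := tangent y (y + t * v); lra.
apply/cvgrPdist_le => e e0; near=> y.
have : derive1 f y * 1 < derive1 f x * 1 + e by near: y; exact: upper.
have : derive1 f y * -1 < derive1 f x * -1 + e by near: y; exact: upper.
by rewrite ler_norml => ? ?; apply/andP; split; lra.
Unshelve. all: by end_near. Qed.

Lemma strongly_convex_derive1_continuous (beta : R) f :
  0 <= beta -> strongly_convex beta f -> (forall x, derivable f x 1) ->
  continuous (derive1 f).
Proof.
move=> beta0 scf df; apply: tangent_derive1_continuous => // x y.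
have := strongly_convex_tangent y scf (df x).
have : 0 <= beta / 2 * (y - x) ^+ 2 by rewrite mulr_ge0 ?sqr_ge0 // divr_ge0.
lra.
Qed.

Lemma quadratic_growth_minimizer f x (s b : R) : continuous f -> 0 < b ->
  (forall z, f x + s * (z - x) + b * (z - x) ^+ 2 <= f z) ->
  exists p, forall z, f p <= f z.
Proof.
move=> fc b0 growth; pose r := `|s| / b.
have r0 : 0 <= r by rewrite divr_ge0 // ltW.
have [||p _ pmin] := @EVT_min R f (x - r) (x + r); first by lra.
  exact: continuous_subspaceT.
have pfx : f p <= f x by apply: pmin; rewrite in_itv /=; apply/andP; split; lra.
exists p => z; have [|zout] := boolP (z \in `[x - r, x + r]); first exact: pmin.
apply: (le_trans pfx); apply: le_trans (growth z).
have rz : r <= `|z - x|.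
  rewrite leNgt; apply/negP => /ltW; rewrite ler_distl => zin.
  by move: zout; rewrite in_itv /= zin.
have : `|s| <= b * `|z - x| by rewrite mulrC -ler_pdivrMr.
have : - (s * (z - x)) <= `|s| * `|z - x| by rewrite -normrM -normrN ler_norm.
rewrite -(real_normK (num_real (z - x))); have := normr_ge0 (z - x).
by nra.
Qed.

End convex_functions.

(** * Subgradients and proximal maps *)

Definition subgradient {R : realType} (g : R -> \bar R) (x s : R) :=
  g x \is a fin_num /\ forall z, (g x + (s * (z - x))%:E <= g z)%E.

Definition proximable {R : realType} (g : R -> \bar R) :=
  forall y, subgradient g (prox g y) (y - prox g y).

Section subgradients.
Context {R : realType}.
Implicit Types (g : R -> \bar R) (x y s t lo hi : R).

Lemma subgradient_EFin (g : R -> R) x s :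
  subgradient (fun z => (g z)%:E) x s <-> forall z, g x + s * (z - x) <= g z.
Proof.
split=> [[_ sg] z|sg]; first by have := sg z; rewrite -EFinD lee_fin.
by split=> // z; rewrite -EFinD lee_fin.
Qed.

Lemma subgradient_itv lo hi x s :
  subgradient (indicator_itv lo hi) x s <->
  lo <= x <= hi /\ forall z, lo <= z <= hi -> s * (z - x) <= 0.
Proof.
rewrite /subgradient /indicator_itv; case: ifPn => xin; last first.
  by split=> [[]|[]].
split=> [[_ sg]|[_ sg]]; split=> // z; last first.
  by case: ifPn => [/sg|_]; rewrite add0e ?leey ?lee_fin.
by move=> zin; have := sg z; rewrite zin add0e lee_fin.
Qed.

Lemma subgradient_monotone g x y s t :
  subgradient g x s -> subgradient g y t -> 0 <= (s - t) * (x - y).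
Proof.
move=> [gx sgx] [gy sgy]; move: (sgx y) (sgy x).
by rewrite -(fineK gx) -(fineK gy) -!EFinD !lee_fin; nra.
Qed.

Lemma prox_eq g y x : subgradient g x (y - x) -> prox g y = x.
Proof.
move=> [gx sg]; rewrite /prox -(fineK gx) in sg *; apply: xget_unique.
  split=> [|z]; first by rewrite -(fineK gx) ltry.
  rewrite -(fineK gx); have := sg z; case: (g z) => [r||] //=.
    by rewrite -!EFinD !lee_fin; have := sqr_ge0 (z - x); nra.
  by rewrite addye ?leey.
move=> z [+ /(_ x)]; rewrite -(fineK gx); have := sg z; case: (g z) => [r||] //= + _.
rewrite -!EFinD !lee_fin => below above; apply/eqP; rewrite -subr_eq0 -sqrf_eq0.
by rewrite eq_le sqr_ge0 andbT; nra.
Qed.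

Lemma prox_continuous g : proximable g -> continuous (prox g).
Proof.
move=> gprox y; apply: (@locally_lipschitz_continuous _ _ _ 1); near=> z.
have mono := subgradient_monotone (gprox z) (gprox y).
rewrite mul1r -ler_sqr ?nnegrE // !real_normK ?num_real //.
have := sqr_ge0 (z - prox g z - (y - prox g y)); nra.
Unshelve. all: by end_near. Qed.

Lemma itv_proximable lo hi : lo <= hi -> proximable (indicator_itv lo hi).
Proof.
move=> lohi y; pose p := Num.max lo (Num.min y hi).
suff sgp : subgradient (indicator_itv lo hi) p (y - p) by rewrite (prox_eq sgp).
apply/subgradient_itv; rewrite /p; split=> [|z /andP[lz zh]].
  by rewrite le_max lexx ge_max lohi ge_min lexx orbT.
by have [yh|hy] := leP y hi; have [ly|yl] := leP lo; nra.
Qed.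

End subgradients.

Section convex_subgradients.
Context {R : realType}.
Implicit Types (f g : R -> R) (x y z : R).

Lemma convex_slope_le g x y z : convex_on_R g -> y < x -> x < z ->
  (g x - g y) / (x - y) <= (g z - g x) / (z - x).
Proof.
move=> cg yx xz.
have xy0 : 0 < x - y by rewrite subr_gt0.
have zx0 : 0 < z - x by rewrite subr_gt0.
have zy0 : 0 < z - y by lra.
pose t := (x - y) / (z - y).
have tzy : t * (z - y) = x - y by rewrite divfK // gt_eqF.
have t01 : 0 <= t <= 1.
  by rewrite divr_ge0 ?(ltW xy0) ?(ltW zy0) //= ler_pdivrMr // mul1r lerD2r ltW.
have gx : g x <= t * g z + (1 - t) * g y.
  by have := cg z y t t01; rewrite (_ : t * z + _ = x) //; lra.
rewrite ler_pdivrMr // mulrAC ler_pdivlMr //.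
have : (z - y) * g x <= (z - y) * (t * g z + (1 - t) * g y) by rewrite ler_pM2l.
rewrite (_ : _ * (_ + _) = t * (z - y) * (g z - g y) + (z - y) * g y); last by ring.
by rewrite tzy; lra.
Qed.

(* The supremum of the left slopes lies below every right slope. *)
Lemma convex_subgradient_exists g x : convex_on_R g ->
  exists s, subgradient (fun z => (g z)%:E) x s.
Proof.
move=> cg; pose S := [set (g x - g y) / (x - y) | y in [set y | y < x]].
have S0 : S !=set0 by exists ((g x - g (x - 1)) / (x - (x - 1))), (x - 1) => //=; lra.
have ubS z : x < z -> ubound S ((g z - g x) / (z - x)).
  by move=> xz _ [y /= yx <-]; exact: convex_slope_le.
have supS : has_sup S.
  by split=> //; exists ((g (x + 1) - g x) / (x + 1 - x)); apply: ubS; lra.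
exists (sup S); apply/subgradient_EFin => z.
have [zx|xz|<-] := ltgtP z x; last by rewrite subrr mulr0 addr0.
- have : (g x - g z) / (x - z) <= sup S by apply: (ub_le_sup supS.2); exists z.
  by rewrite ler_pdivrMr ?subr_gt0 //; lra.
- have : sup S <= (g z - g x) / (z - x) by apply: ge_sup => //; exact: ubS.
  by rewrite ler_pdivlMr ?subr_gt0 //; lra.
Qed.

(* Near [x], every subgradient lies between one at [x - 1] and one at [x + 1]. *)
Lemma convex_continuous g : convex_on_R g -> continuous g.
Proof.
move=> cg x; have sg z := convex_subgradient_exists z cg.
have [[[s sgx] [sl sgl]] [sr sgr]] := (sg x, sg (x - 1), sg (x + 1)).
pose k := `|s| + `|sl| + `|sr|.
apply: (@locally_lipschitz_continuous _ _ _ k); near=> y.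
have : `|x - y| < 1 by near: y; apply: cvgr_dist_lt; [exact: cvg_id|exact: ltr01].
rewrite ltr_distl => /andP[xl xr]; have [t ty] := sg y.
have := subgradient_monotone ty sgl; have := subgradient_monotone sgr ty.
move/subgradient_EFin/(_ y): sgx; move/subgradient_EFin/(_ x): ty => *.
have /andP[slt tsr] : sl <= t <= sr by apply/andP; split; nra.
have s_le : `|s * (y - x)| <= k * `|y - x|.
  by rewrite normrM ler_wpM2r // /k -addrA lerDl addr_ge0.
have t_le : `|t * (y - x)| <= k * `|y - x|.
  rewrite normrM ler_wpM2r // ler_norml /k.
  have := ler_norm sr; have := ler_norm (- sl); rewrite normrN.
  by have := (normr_ge0 s, normr_ge0 sl, normr_ge0 sr) => -[[]] *; apply/andP; split; lra.
rewrite !ler_norml in s_le t_le *; move: s_le t_le => /andP[s_le _] /andP[_ t_le].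
by apply/andP; split; lra.
Unshelve. all: by end_near. Qed.

Lemma convex_sum_stationary (beta : R) f g : 0 < beta ->
  strongly_convex beta f -> (forall x, derivable f x 1) -> convex_on_R g ->
  exists p, subgradient (fun z => (g z)%:E) p (- derive1 f p).
Proof.
move=> beta0 scf df cg; have [s /subgradient_EFin sg] := convex_subgradient_exists 0 cg.
have [| |z|p pmin] := @quadratic_growth_minimizer _ (f \+ g) 0 (derive1 f 0 + s) (beta / 2).
- move=> x; apply: cvgD; [exact: derivable1_continuous|exact: convex_continuous].
- by rewrite divr_gt0.
- by have := strongly_convex_tangent z scf (df 0); have := sg z; rewrite /=; lra.
exists p; apply/subgradient_EFin => z.
suff : - (g z - g p) <= derive1 f p * (z - p) by lra.
apply: (cvgr_to_ge (cvg_right_slope (df p))); near=> t.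
have t0 : 0 < t by near: t; exact: nbhs_right_gt.
have t1 : t <= 1 by near: t; exact: nbhs_right_le.
rewrite ler_pdivlMr //; have := pmin (p + t * (z - p)); rewrite /=.
have := cg z p t; rewrite (ltW t0) t1 => /(_ isT).
have -> : t * z + (1 - t) * p = p + t * (z - p) by ring.
by nra.
Unshelve. all: by end_near. Qed.

Lemma convex_proximable g : convex_on_R g -> proximable (fun z => (g z)%:E).
Proof.
move=> cg y; pose q (z : R) := (z - y) ^+ 2 / 2.
have dq z : is_derive z 1 q (z - y).
  have -> : q = 2^-1 \*: ((id - cst y) ^+ 2) by apply/funext => t; rewrite /q !fctE mulrC.
  by apply: is_derive_eq; rewrite /GRing.scale /= !fctE; field.
have [||z|p] := @convex_sum_stationary 1 q g _ _ _ cg; first exact: ltr01.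
- by move=> u v t _; rewrite /q; nra.
- exact: (@ex_derive _ _ _ _ _ _ _ (dq z)).
rewrite derive1E derive_val opprB => sgp.
by rewrite (prox_eq sgp).
Qed.

End convex_subgradients.

(** * Response of the buses to a common price *)

(* [d] minimizes [f0 + f2 - m x] over [[lo, hi]], as certified by the
   subgradient [s] of [f2]. *)
Definition node_optimum {R : realType} (lo hi : R) (f0 f2 : R -> R) (m d s : R) :=
  subgradient (indicator_itv lo hi) d (m - derive1 f0 d - s) /\
  subgradient (fun x => (f2 x)%:E) d s.

Section node_optimum.
Context {R : realType} (lo hi beta : R) (f0 f2 : R -> R).
Hypothesis lo_le_hi : lo <= hi.
Hypothesis beta_gt0 : 0 < beta.
Hypothesis f0_derivable : forall x, derivable f0 x 1.
Hypothesis f0_strongly_convex : strongly_convex beta f0.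
Hypothesis f2_convex : convex_on_R f2.

Local Notation optimum := (node_optimum lo hi f0 f2).

Lemma node_optimum_monotone (m d s m' d' s' : R) :
  optimum m d s -> optimum m' d' s' -> beta * (d - d') ^+ 2 <= (m - m') * (d - d').
Proof.
move=> [din ds] [d'in ds'].
have := subgradient_monotone din d'in; have := subgradient_monotone ds ds'.
have := strongly_convex_monotone f0_strongly_convex (@f0_derivable d) (@f0_derivable d').
nra.
Qed.

Lemma node_optimum_le (m d s m' d' s' : R) :
  optimum m d s -> optimum m' d' s' -> m <= m' -> d <= d'.
Proof.
move=> opt opt' mm'; rewrite leNgt; apply/negP; rewrite -subr_gt0 => d'd.
have := node_optimum_monotone opt opt'.
have : 0 < beta * (d - d') ^+ 2 by rewrite mulr_gt0 ?exprn_gt0.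
nra.
Qed.

(* The unconstrained minimizer is projected onto [[lo, hi]]; by monotonicity every
   subgradient of [f2] at an active bound is a certificate. *)
Lemma node_optimum_exists (m : R) : exists d s, optimum m d s.
Proof.
have tilted_convex : convex_on_R (fun x => f2 x - m * x).
  by move=> x y t /(f2_convex x y); nra.
have [p /subgradient_EFin stat] :=
  convex_sum_stationary beta_gt0 f0_strongly_convex f0_derivable tilted_convex.
have sgp : subgradient (fun x => (f2 x)%:E) p (m - derive1 f0 p).
  by apply/subgradient_EFin => z; have := stat z; lra.
have mono q := strongly_convex_monotone f0_strongly_convex (@f0_derivable p) (@f0_derivable q).
have mono_ge0 q : 0 <= (derive1 f0 p - derive1 f0 q) * (p - q).
  by apply: le_trans (mono q); rewrite mulr_ge0 ?sqr_ge0 ?ltW.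
have [plo|lop] := ltP p lo; last have [hip|phi] := ltP hi p.
- have [s sgs] := convex_subgradient_exists lo f2_convex; exists lo, s; split=> //.
  apply/subgradient_itv; rewrite lexx; split=> // z /andP[loz _].
  by have := subgradient_monotone sgp sgs; have := mono_ge0 lo; nra.
- have [s sgs] := convex_subgradient_exists hi f2_convex; exists hi, s; split=> //.
  apply/subgradient_itv; rewrite lexx andbT; split=> // z /andP[_ zhi].
  by have := subgradient_monotone sgp sgs; have := mono_ge0 hi; nra.
- exists p, (m - derive1 f0 p); split=> //.
  by apply/subgradient_itv; rewrite lop phi; split=> // z _; rewrite subrr mul0r.
Qed.

Lemma node_response_exists : exists d s : R -> R,
  [/\ forall m, optimum m (d m) (s m), continuous d & {homo d : m m' / m <= m'}].
Proof.
have /choice[d /choice[s opt]] := node_optimum_exists.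
exists d, s; split=> // [m|m m']; last exact: node_optimum_le.
apply: (@locally_lipschitz_continuous _ _ _ beta^-1); near=> m'.
rewrite mulrC ler_pdivlMr // mulrC.
have [->|dd'] := eqVneq (d m') (d m); first by rewrite subrr normr0 mulr0.
rewrite -(ler_pM2r (x := `|d m' - d m|)) ?normr_gt0 ?subr_eq0 //.
rewrite -mulrA -expr2 real_normK ?num_real // -normrM.
exact: le_trans (node_optimum_monotone (opt m') (opt m)) (ler_norm _).
Unshelve. all: by end_near. Qed.

Lemma node_optimum_attained (c : R) : lo <= c <= hi -> exists m s, optimum m c s.
Proof.
move=> cin; have [s sg] := convex_subgradient_exists c f2_convex.
exists (derive1 f0 c + s), s; split=> //; apply/subgradient_itv; split=> // z _.
by rewrite (_ : _ - _ - s = 0) ?mul0r //; ring.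
Qed.

End node_optimum.

Lemma sum_response_attains {R : realType} {I : finType} (d : I -> R -> R) (c : I -> R) :
  (forall i, continuous (d i)) -> (forall i, {homo d i : m m' / m <= m'}) ->
  (forall i, exists m, d i m = c i) -> exists m, \sum_i d i m = \sum_i c i.
Proof.
move=> dc dmono /choice[m mE]; pose M := \sum_i `|m i|.
have m_le i : `|m i| <= M by rewrite /M (bigD1 i) //= lerDl sumr_ge0.
have M0 : 0 <= M by exact: sumr_ge0.
have [|||mu _ muE] := @IVT R (fun mu => \sum_i d i mu) (- M) M (\sum_i c i).
- by lra.
- apply: continuous_subspaceT => mu.
  by apply: cvg_bigsum => i _; exact: dc.
- rewrite ge_min le_max; apply/andP; split; apply/orP; [left|right];
    apply: ler_sum => i _; rewrite -mE; apply: dmono;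
    by have := m_le i; rewrite ler_norml => /andP[].
- by exists mu.
Qed.

Lemma balanced_node_optimum {R : realType} {I : finType} (lo hi : I -> R)
    (f0 f2 : I -> R -> R) (beta : R) (c : I -> R) :
  0 < beta -> (forall i x, derivable (f0 i) x 1) ->
  (forall i, strongly_convex beta (f0 i)) -> (forall i, convex_on_R (f2 i)) ->
  (forall i, lo i <= c i <= hi i) ->
  exists m (d s : I -> R),
    (forall i, node_optimum (lo i) (hi i) (f0 i) (f2 i) m (d i) (s i)) /\
    \sum_i d i = \sum_i c i.
Proof.
move=> beta0 df0 scf0 cf2 cin.
have lo_hi i : lo i <= hi i by have /andP[] := cin i; exact: le_trans.
have /choice[d /choice[s resp]] i :=
  node_response_exists (lo_hi i) beta0 (df0 i) (scf0 i) (cf2 i).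
have [m dm] : exists m, \sum_i d i m = \sum_i c i.
  apply: sum_response_attains => i; [by have [] := resp i|by have [] := resp i|].
  have [m [s' opt']] := node_optimum_attained (f0 i) (cf2 i) (cin i).
  have [opt _ _] := resp i; exists m; apply/eqP; rewrite eq_le.
  rewrite (node_optimum_le beta0 (df0 i) (scf0 i) (opt m) opt') //.
  by rewrite (node_optimum_le beta0 (df0 i) (scf0 i) opt' (opt m)).
by exists m, (d^~ m), (s^~ m); split=> // i; have [] := resp i.
Qed.

(** * Divergence and Laplacian of a network *)

Section divergence.
Context {R : comPzRingType} {T : finType} (E : rel T).
Implicit Types (F G B : T -> T -> R) (x y : T -> R).

Definition divergence F i : R := \sum_(j | E i j) F i j - \sum_(k | E k i) F k i.

Definition laplacian B x : T -> R := divergence (fun i j => B i j * (x i - x j)).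

Lemma eq_divergence F G : (forall i j, E i j -> F i j = G i j) ->
  divergence F =1 divergence G.
Proof. by move=> FG i; congr (_ - _); apply: eq_bigr => j /FG. Qed.

Lemma divergenceB F G i :
  divergence (fun i j => F i j - G i j) i = divergence F i - divergence G i.
Proof. by rewrite /divergence !sumrB; ring. Qed.

Lemma laplacianB B x y i :
  laplacian B (fun i => x i - y i) i = laplacian B x i - laplacian B y i.
Proof. by rewrite -divergenceB; apply: eq_divergence => j k _; ring. Qed.

Lemma sum_mul_divergence F x :
  \sum_i x i * divergence F i = \sum_i \sum_(j | E i j) F i j * (x i - x j).
Proof.
under eq_bigr do rewrite mulrBr !mulr_sumr.
under [RHS]eq_bigr => i _ do (under eq_bigr do rewrite mulrBr; rewrite sumrB).
rewrite !sumrB; congr (_ - _); last rewrite (exchange_big_dep predT) //=;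
  by apply: eq_bigr => i _; apply: eq_bigr => j _; rewrite mulrC.
Qed.

Lemma sum_divergence F : \sum_i divergence F i = 0.
Proof.
under eq_bigr do rewrite -[divergence F _]mul1r.
rewrite (sum_mul_divergence F (fun=> 1)) big1 // => i _.
by rewrite big1 // => j _; rewrite subrr mulr0.
Qed.

Lemma sum_mul_laplacian B x y :
  \sum_i x i * laplacian B y i =
  \sum_i \sum_(j | E i j) B i j * ((x i - x j) * (y i - y j)).
Proof.
by rewrite sum_mul_divergence; apply: eq_bigr => i _; apply: eq_bigr => j _; ring.
Qed.

Lemma laplacian_sym B x y :
  \sum_i x i * laplacian B y i = \sum_i y i * laplacian B x i.
Proof.
by rewrite !sum_mul_laplacian; apply: eq_bigr => i _; apply: eq_bigr => j _; ring.
Qed.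

End divergence.

Lemma weakly_connected_const {n : nat} (E : rel 'I_n) (T : Type) (x : 'I_n -> T) :
  weakly_connected E -> (forall i j, E i j -> x i = x j) -> forall i j, x i = x j.
Proof.
move=> conn xE i j; have /connectP[p + ->] := conn i j.
by elim: p i => [|k p IH] i //= /andP[/orP[/xE -> |/xE <-]]; exact: IH.
Qed.

Lemma symmetric_submx {F : fieldType} {m n : nat} (A : 'M[F]_n) (B : 'M[F]_(m, n)) :
  A^T = A -> (forall x : 'rV[F]_n, x *m A = 0 -> B *m x^T = 0) -> (B <= A)%MS.
Proof.
move=> symA orth; rewrite submxE; apply/eqP/matrixP => i k.
have /orth : (col k (cokermx A))^T *m A = 0.
  by rewrite -[X in _ *m X]symA -trmx_mul colE mulmxA mulmx_coker mul0mx trmx0.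
by rewrite trmxK colE mulmxA -colE => /colP/(_ i); rewrite !mxE.
Qed.

Section connected_laplacian.
Context {R : realFieldType} {n : nat} (E : rel 'I_n) (B : 'I_n -> 'I_n -> R).
Hypothesis E_connected : weakly_connected E.
Hypothesis B_gt0 : forall i j, E i j -> 0 < B i j.

Lemma laplacian_eq0 (x : 'I_n -> R) :
  (forall i, laplacian E B x i = 0) -> forall i j, x i = x j.
Proof.
move=> lap0; apply: weakly_connected_const E_connected _ => i j Eij.
have energy_ge0 k l : E k l -> 0 <= B k l * ((x k - x l) * (x k - x l)).
  by move=> Ekl; rewrite mulr_ge0 ?(ltW (B_gt0 Ekl)) // -expr2 sqr_ge0.
have := sum_mul_laplacian E B x x; rewrite big1 => [|k _]; last by rewrite lap0 mulr0.
move/esym/psumr_eq0P => /(_ (fun k _ => sumr_ge0 _ (fun l => @energy_ge0 k l)) i isT).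
move/psumr_eq0P => /(_ (fun l => @energy_ge0 i l) j Eij)/eqP.
by rewrite mulf_eq0 (gt_eqF (B_gt0 Eij)) -expr2 sqrf_eq0 subr_eq0 => /eqP.
Qed.

(* The Laplacian is symmetric with kernel the constants, so its image is the
   orthogonal complement of the constants. *)
Lemma laplacian_surjective (b : 'I_n -> R) :
  \sum_i b i = 0 -> exists x, forall i, laplacian E B x i = b i.
Proof.
move=> sumb0; pose e (j k : 'I_n) : R := (k == j)%:R.
have sum_e i (y : 'I_n -> R) : \sum_k e i k * y k = y i.
  rewrite (bigD1 i) //= big1 => [|k /negbTE ki]; last by rewrite /e ki mul0r.
  by rewrite /e eqxx mul1r addr0.
pose L : 'M[R]_n := \matrix_(i, j) laplacian E B (e i) j.
have symL : L^T = L.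
  by apply/matrixP => i j; rewrite !mxE -[LHS]sum_e laplacian_sym sum_e.
have LE (x : 'rV[R]_n) i : (x *m L) 0 i = laplacian E B (x 0) i.
  rewrite -[RHS]sum_e laplacian_sym mxE; apply: eq_bigr => j _.
  by rewrite -[L]symL !mxE.
pose bv : 'rV[R]_n := \row_i b i.
have /submxP[x xL] : (bv <= L)%MS.
  apply: symmetric_submx symL _ => y yL; apply/rowP => k; rewrite (ord1 k) !mxE.
  have const_y : forall i j, y 0 i = y 0 j.
    by apply: laplacian_eq0 => i; rewrite -LE yL mxE.
  have [i0 _|no_bus] := pickP 'I_n; last by rewrite big1 // => i; have := no_bus i.
  under eq_bigr => i _ do rewrite !mxE (const_y i i0).
  by rewrite -mulr_suml sumb0 mul0r.
by exists (x 0) => i; rewrite -LE -xL mxE.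
Qed.

End connected_laplacian.

(** * Convergence from a family of Lyapunov functions *)

(* The zeros of [W] are the equilibria; each equilibrium [y] has its own Lyapunov
   function [V y], dissipated at rate at least [W] along the trajectory [X]. *)
Record lyapunov_family {R : realType} {T : topologicalType} (X : R -> T)
    (V : T -> T -> R) (W : T -> R) : Prop := LyapunovFamily {
  loss_continuous : continuous W;
  loss_ge0 : forall x, 0 <= W x;
  energy_ge0 : forall y x, W y = 0 -> 0 <= V y x;
  energy_cvg0 : forall y, W y = 0 -> V y x @[x --> y] --> 0;
  energy_derivable : forall y (t : R), W y = 0 -> 0 < t ->
    derivable (fun s => V y (X s)) t 1;
  energy_decay : forall y (t : R), W y = 0 -> 0 < t ->
    derive1 (fun s => V y (X s)) t <= - W (X t) }.

Section lyapunov_family.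
Context {R : realType} {T : topologicalType} (X : R -> T) (V : T -> T -> R) (W : T -> R).
Hypothesis family : lyapunov_family X V W.

Lemma energy_nonincreasing y (s t : R) : W y = 0 -> 0 < s -> s <= t ->
  V y (X t) <= V y (X s).
Proof.
move=> Wy s0 st; rewrite -subr_le0 -[leRHS](mul0r (t - s)).
apply: (derive1_le_increment (f := fun s => V y (X s)) st) => r /andP[sr _];
  have r0 := lt_le_trans s0 sr; first exact: (energy_derivable family Wy r0).
by apply: le_trans (energy_decay family Wy r0) _; rewrite oppr_le0 (loss_ge0 family).
Qed.

Lemma late_small_loss y (s e : R) : W y = 0 -> 0 < s -> 0 < e ->
  exists2 t, s <= t & W (X t) <= e.
Proof.
move=> Wy s0 e0; apply: contrapT => large_loss.
have Vs := energy_ge0 family (X s) Wy; pose t := s + (V y (X s) + 1) / e.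
have st : s <= t by rewrite lerDl divr_ge0 ?addr_ge0 // ltW.
have drop : V y (X t) - V y (X s) <= - e * (t - s).
  apply: (derive1_le_increment (f := fun s => V y (X s)) st) => r /andP[sr _];
    have r0 := lt_le_trans s0 sr; first exact: (energy_derivable family Wy r0).
  apply: le_trans (energy_decay family Wy r0) _; rewrite lerN2 leNgt.
  by apply/negP => /ltW We; apply: large_loss; exists r.
have : - e * (t - s) = - (V y (X s) + 1) by rewrite /t; field; rewrite gt_eqF.
by have := energy_ge0 family (X t) Wy; lra.
Qed.

Lemma low_loss_limit_point (K : set T) (xs : T) (t0 : R) :
  compact K -> 0 < t0 -> (forall t, t0 <= t -> K (X t)) -> W xs = 0 ->
  exists y : T, forall (e : R) A, 0 < e -> nbhs y A ->
    exists2 t, t0 <= t & W (X t) < e /\ A (X t).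
Proof.
move=> Kcompact t00 XK Wxs.
have /choice[tau tauP] (k : nat) : exists t, t0 <= t /\ W (X t) <= k.+1%:R^-1.
  have [|t t0t Wt] := late_small_loss (e := k.+1%:R^-1) Wxs t00; last by exists t.
  by rewrite invr_gt0.
have tauK : \forall k \near \oo, K (X (tau k)).
  by apply: nearW => k; apply: XK; have [] := tauP k.
have [y [_ cluster_y]] := Kcompact ((X \o tau) @ \oo) _ tauK.
exists y => e A e0 Ay.
have loss_small : \forall k \near \oo, W (X (tau k)) < e.
  near=> k; apply: le_lt_trans (tauP k).2 _; near: k.
  exact: near_infty_natSinv_lt (PosNum e0).
pose low_loss := (X \o tau) @` [set k | W (X (tau k)) < e].
have often_low : ((X \o tau) @ \oo) low_loss by apply: filterS loss_small => k We; exists k.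
have [_ [[k We <-] Ak]] := cluster_y low_loss A often_low Ay.
by exists (tau k) => //; exact: (tauP k).1.
Unshelve. all: by end_near. Qed.

Lemma lyapunov_family_cvg (K : set T) (xs : T) (t0 : R) :
  compact K -> 0 < t0 -> (forall t, t0 <= t -> K (X t)) -> W xs = 0 ->
  exists2 y, W y = 0 & V y (X t) @[t --> +oo] --> 0.
Proof.
move=> Kcompact t00 XK Wxs.
have [y visits] := low_loss_limit_point Kcompact t00 XK Wxs.
have Wy : W y = 0.
  apply/eqP; rewrite eq_le (loss_ge0 family) andbT.
  apply/ler_addgt0Pl => e e0; rewrite addr0; have e2 : 0 < e / 2 by rewrite divr_gt0.
  have /cvgrPdist_lt/(_ _ e2)/(visits _ _ e2)[t _ [Wt]] := @loss_continuous _ _ _ _ _ family y.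
  by rewrite ltr_distl => /andP[]; lra.
exists y => //; apply/cvgrPdist_le => e e0.
have /cvgrPdist_le/(_ _ e0)/(visits _ _ e0)[s t0s [_ Vs]] := energy_cvg0 family Wy.
near=> t; have st : s <= t by near: t; apply: nbhs_pinfty_ge; exact: num_real.
rewrite !sub0r !normrN !ger0_norm ?(energy_ge0 family) // in Vs *; apply: le_trans Vs.
exact: (energy_nonincreasing Wy (lt_le_trans t00 t0s) st).
Unshelve. all: by end_near. Qed.

End lyapunov_family.

Section coercive_lyapunov_family.
Context {R : realType} {I : eqType} (X : R -> {ptws I -> R}).
Variables (V : {ptws I -> R} -> {ptws I -> R} -> R) (W : {ptws I -> R} -> R) (c : R).
Hypothesis family : lyapunov_family X V W.
Hypothesis c_gt0 : 0 < c.
Hypothesis energy_coercive : forall y x i, W y = 0 -> c * (x i - y i) ^+ 2 <= V y x.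

Lemma coercive_lyapunov_bounded xs (t0 : R) : W xs = 0 -> 0 < t0 ->
  exists r, forall t i, t0 <= t -> `|X t i - xs i| <= r.
Proof.
move=> Wxs t00; have V0 := energy_ge0 family (X t0) Wxs.
pose q := V xs (X t0) / c; have q0 : 0 <= q by rewrite divr_ge0 // ltW.
exists (1 + q) => t i t0t; rewrite -ler_sqr ?nnegrE ?addr_ge0 // real_normK ?num_real //.
have := le_trans (energy_coercive (X t) i Wxs) (energy_nonincreasing family Wxs t00 t0t).
by rewrite mulrC -ler_pdivlMr // -/q; nra.
Qed.

Lemma coercive_lyapunov_cvg xs : W xs = 0 ->
  exists2 y, W y = 0 & forall i, X t i @[t --> +oo] --> y i.
Proof.
move=> Wxs; have [r X_bounded] := coercive_lyapunov_bounded Wxs ltr01.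
pose box i := `[xs i - r, xs i + r]%classic.
have box_compact : compact [set x : {ptws I -> R} | forall i, box i (x i)].
  by apply: (@tychonoff I (fun=> R) box) => i; exact: segment_compact.
have [t t1 i|y Wy Vy0] := lyapunov_family_cvg family box_compact ltr01 _ Wxs.
  by rewrite /box /= in_itv /= -ler_distl; exact: X_bounded.
exists y => // i; apply: (@cvg_sqr_dominated _ _ _ _ _ (fun t => V y (X t) / c)).
  by apply: nearW => t; rewrite ler_pdivlMr // mulrC; exact: energy_coercive.
by rewrite -(mul0r c^-1); apply: cvgM Vy0 _; exact: cvg_cst.
Qed.

End coercive_lyapunov_family.

(** * Invariant intervals and bounds on half-lines *)

Lemma bounded_fwd_eventually {R : realType} (f : R -> R) (a r t0 : R) :
  {within `[0, +oo[%classic, continuous f} -> 0 <= t0 ->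
  (forall t, t0 <= t -> `|f t - a| <= r) -> bounded_fwd f.
Proof.
move=> fc t00 f_late.
have norm_fc : {within `[0, t0], continuous (fun t => `|f t|)}.
  have sub0y : `[0, t0] `<=` `[0, +oo[%classic by exact: subset_itvl.
  by move=> t; apply: cvg_norm; exact: continuous_subspaceW sub0y fc t.
have [u _ u_max] := @EVT_max R (fun t => `|f t|) 0 t0 t00 norm_fc.
exists (Num.max (`|f u|) (r + `|a|)) => t t_ge0; rewrite le_max.
have [t0t|/ltW tt0] := leP t0 t; last by rewrite u_max // in_itv /= t_ge0.
apply/orP; right; rewrite -[f t](subrK a); apply: le_trans (ler_normD _ _) _.
by rewrite lerD2r f_late.
Qed.

(* [expR t * (x t - b)] has derivative [expR t * (p t - b) <= 0]. *)
Lemma relaxation_le {R : realType} (x p : R -> R) (b : R) :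
  {within `[0, +oo[%classic, continuous x} ->
  (forall t : R, 0 < t -> is_derive t 1 x (p t - x t)) -> (forall t, 0 < t -> p t <= b) ->
  x 0 <= b -> forall t, 0 <= t -> x t <= b.
Proof.
move=> xc dx pb x0 t t0; pose g s := expR s * (x s - b).
have dg (s : R) : 0 < s -> is_derive s 1 g (expR s * (p s - b)).
  by move=> /dx dxs; apply: is_derive_eq; rewrite /GRing.scale /=; ring.
have gc : {within `[0, +oo[%classic, continuous g}.
  move=> s; apply: cvgM; first by apply: continuous_subspaceT; exact: continuous_expR.
  by apply: cvgB; [exact: xc|exact: cvg_cst].
have : g t <= g 0.
  apply: (ler0_derive1_nincry _ _ gc) => // s; rewrite in_itv /= andbT => s0;
    have dgs := dg s s0; first exact: ex_derive.
  by rewrite derive1E derive_val pmulr_rle0 ?expR_gt0 // subr_le0 pb.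
rewrite /g expR0 mul1r => gt; rewrite -subr_le0 -(pmulr_rle0 _ (expR_gt0 t)).
by apply: le_trans gt _; rewrite subr_le0.
Qed.

Lemma relaxation_invariant {R : realType} (x p : R -> R) (a b : R) :
  {within `[0, +oo[%classic, continuous x} ->
  (forall t : R, 0 < t -> is_derive t 1 x (p t - x t)) ->
  (forall t, 0 < t -> a <= p t <= b) ->
  a <= x 0 <= b -> forall t, 0 <= t -> a <= x t <= b.
Proof.
move=> xc dx pab /andP[ax xb] t t0; apply/andP; split; last first.
  by apply: (relaxation_le xc dx) => // s /pab/andP[].
rewrite -lerN2; apply: (relaxation_le (x := \- x) (p := \- p)) => //.
- by move=> s; apply: cvgN; exact: xc.
- by move=> s /dx dxs; apply: is_derive_eq; rewrite /=; ring.
- by move=> s /pab/andP[]; rewrite lerN2.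
- by rewrite /= lerN2.
Qed.

(** * The DPPD vector field and its equilibria *)

Lemma u1E {R : realType} {n : nat} (E : rel 'I_n) (Pin D d w : 'I_n -> R)
    (P : 'I_n -> 'I_n -> R) i :
  u1 E Pin D d w P i = Pin i - d i - D i * w i - divergence E P i.
Proof. by rewrite /u1 /divergence; ring. Qed.

Lemma u2E {R : realType} {n : nat} (E : rel 'I_n) (B : 'I_n -> 'I_n -> R)
    (Pin d th : 'I_n -> R) i :
  u2 E B Pin d th i = Pin i - d i - laplacian E B th i.
Proof. by rewrite /u2 /laplacian /divergence; ring. Qed.

Inductive coord (n : nat) :=
  | Eta of 'I_n | Demand of 'I_n | Angle of 'I_n
  | Flow of 'I_n & 'I_n | Freq of 'I_n | Price of 'I_n.

HB.instance Definition _ (n : nat) := gen_eqMixin (coord n).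

Definition flow {R : realType} {n : nat} (x : {ptws coord n -> R}) (i j : 'I_n) : R :=
  x (Flow i j).

(* A state has a flow coordinate for every pair of buses; the coordinates of pairs
   that are not lines stay constant and enter no balance equation. *)
Definition on_lines {R : realType} {n : nat} (E : rel 'I_n) (P : 'I_n -> 'I_n -> R) i j : R :=
  if E i j then P i j else 0.

Section dppd.
Context {R : realType} {n : nat} (E : rel 'I_n) (B : 'I_n -> 'I_n -> R)
  (D Pin lo hi : 'I_n -> R) (f0 f2 : 'I_n -> R -> R) (beta kappa : R).
Hypothesis E_connected : weakly_connected E.
Hypothesis B_gt0 : forall i j, E i j -> 0 < B i j.
Hypothesis D_gt0 : forall i, 0 < D i.
Hypothesis kappa01 : 0 < kappa < 1.
Hypothesis f0_derivable : forall i x, derivable (f0 i) x 1.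
Hypothesis f2_convex : forall i, convex_on_R (f2 i).
Hypothesis beta_gt1 : 1 < beta.
Hypothesis f0_strongly_convex : forall i, strongly_convex beta (f0 i).
Hypothesis lo_le_hi : forall i, lo i <= hi i.

Local Notation state := {ptws coord n -> R}.
Implicit Types (x y xs : state) (i j : 'I_n).

Let beta_gt0 : 0 < beta. Proof. exact: lt_trans ltr01 beta_gt1. Qed.

Definition imbalance x i : R :=
  Pin i - x (Demand i) - D i * x (Freq i) - divergence E (flow x) i.

Definition virtual_imbalance x i : R :=
  Pin i - x (Demand i) - laplacian E B (x \o @Angle n) i.

Definition local_freq x i : R := x (Freq i) + imbalance x i.

Definition local_price x i : R := x (Price i) + virtual_imbalance x i.

Definition vector_field x : state := fun k =>
  match k with
  | Eta i => rhs_eta f2 kappa (x \o @Eta n) (x \o @Demand n) i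
  | Demand i => rhs_d E B Pin D lo hi f0 kappa (x \o @Eta n) (x \o @Demand n)
      (x \o @Angle n) (flow x) (x \o @Freq n) (x \o @Price n) i
  | Angle i => rhs_th E B Pin (x \o @Demand n) (x \o @Angle n) (x \o @Price n) i
  | Flow i j => on_lines E (rhs_P E Pin D (x \o @Demand n) (flow x) (x \o @Freq n)) i j
  | Freq i => rhs_lam E Pin D (x \o @Demand n) (flow x) (x \o @Freq n) i
  | Price i => rhs_mu E B Pin (x \o @Demand n) (x \o @Angle n) i
  end.

Arguments vector_field : simpl never.

Definition equilibrium x := forall k, vector_field x k = 0.

Lemma u1_imbalance x :
  u1 E Pin D (x \o @Demand n) (x \o @Freq n) (flow x) = imbalance x.
Proof. by apply/funext => i; rewrite u1E. Qed.

Lemma u2_virtual_imbalance x :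
  u2 E B Pin (x \o @Demand n) (x \o @Angle n) = virtual_imbalance x.
Proof. by apply/funext => i; rewrite u2E. Qed.

Lemma vector_field_Demand x i : vector_field x (Demand i) =
  prox (indicator_itv (lo i) (hi i)) (x (Demand i) - derive1 (f0 i) (x (Demand i))
    + kappa * x (Eta i) + local_freq x i + local_price x i) - x (Demand i).
Proof.
by rewrite /vector_field /rhs_d u1_imbalance u2_virtual_imbalance /local_freq /local_price !addrA.
Qed.

Lemma vector_field_Angle x i :
  vector_field x (Angle i) = laplacian E B (local_price x) i.
Proof.
rewrite /vector_field /rhs_th u2_virtual_imbalance; congr (_ - _); apply: eq_bigr => j _;
  by congr (_ * _); rewrite /local_price /=; ring.
Qed.

Lemma vector_field_Flow x i j : vector_field x (Flow i j) =
  on_lines E (fun i j => local_freq x i - local_freq x j) i j.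
Proof.
rewrite /vector_field /on_lines /rhs_P u1_imbalance; case: ifP => // _.
by rewrite /local_freq /=; ring.
Qed.

Lemma vector_field_Freq x i : vector_field x (Freq i) = imbalance x i / 2.
Proof. by rewrite /vector_field /rhs_lam u1_imbalance. Qed.

Lemma vector_field_Price x i : vector_field x (Price i) = virtual_imbalance x i / 2.
Proof. by rewrite /vector_field /rhs_mu u2_virtual_imbalance. Qed.

Lemma subgradient_Demand x i :
  subgradient (indicator_itv (lo i) (hi i)) (x (Demand i) + vector_field x (Demand i))
    (kappa * x (Eta i) + local_freq x i + local_price x i
     - derive1 (f0 i) (x (Demand i)) - vector_field x (Demand i)).
Proof.
rewrite vector_field_Demand; set y := (X in prox _ X).
have := itv_proximable (lo_le_hi i) y; congr subgradient; rewrite /y; ring.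
Qed.

Lemma subgradient_Eta x i :
  subgradient (fun z => (f2 i z)%:E) (x (Demand i) + vector_field x (Eta i))
    (- (kappa * x (Eta i)) - vector_field x (Eta i)).
Proof.
have := convex_proximable (f2_convex i) (x (Demand i) - kappa * x (Eta i)).
by congr subgradient; rewrite /vector_field /rhs_eta /=; ring.
Qed.

Lemma sum_imbalance x : \sum_i imbalance x i - \sum_i virtual_imbalance x i =
  - \sum_i D i * x (Freq i).
Proof.
transitivity (- (\sum_i D i * x (Freq i)) - \sum_i divergence E (flow x) i
    + \sum_i laplacian E B (x \o @Angle n) i); last by rewrite !sum_divergence subr0 addr0.
rewrite -!sumrN -!big_split; apply: eq_bigr => i _.
by rewrite /= /imbalance /virtual_imbalance; ring.
Qed.

(* The frequencies agree along lines, and by [sum_imbalance] their [D]-weighted sum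
   vanishes. *)
Lemma equilibrium_balanced x : equilibrium x ->
  [/\ forall i, imbalance x i = 0, forall i, virtual_imbalance x i = 0,
      forall i, x (Freq i) = 0 & forall i j, x (Price i) = x (Price j)].
Proof.
move=> eq_x.
have halfP (r : R) : r / 2 = 0 -> r = 0 by lra.
have imb0 i : imbalance x i = 0 by apply: halfP; rewrite -vector_field_Freq.
have vimb0 i : virtual_imbalance x i = 0 by apply: halfP; rewrite -vector_field_Price.
have const_freq : forall i j, x (Freq i) = x (Freq j).
  apply: (weakly_connected_const E_connected) => i j Eij.
  have := eq_x (Flow i j); rewrite vector_field_Flow /on_lines Eij /local_freq !imb0.
  by rewrite !addr0 => /eqP; rewrite subr_eq0 => /eqP.
split=> // [i|].
  have := sum_imbalance x.
  rewrite [X in X - _]big1 // [X in _ - X = _]big1 // subrr => /esym/eqP; rewrite oppr_eq0.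
  under eq_bigr => j _ do rewrite (const_freq j i).
  rewrite -mulr_suml mulf_eq0 gt_eqF ?orFb => [/eqP //|].
  by rewrite (bigD1 i) //= ltr_pwDl // sumr_ge0 // => j _; exact: ltW.
apply: (laplacian_eq0 E_connected B_gt0) => i; rewrite -(eq_x (Angle i)) vector_field_Angle.
by apply: eq_divergence => j k _; rewrite /local_price !vimb0 !addr0.
Qed.

Lemma equilibriumP x : equilibrium x <->
  [/\ forall i, node_optimum (lo i) (hi i) (f0 i) (f2 i) (x (Price i)) (x (Demand i))
        (- (kappa * x (Eta i))),
      forall i j, x (Price i) = x (Price j), forall i, x (Freq i) = 0,
      forall i, laplacian E B (x \o @Angle n) i = Pin i - x (Demand i) &
      forall i, divergence E (flow x) i = Pin i - x (Demand i)].
Proof.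
split=> [eq_x|[opt const_price freq0 lapE divE]].
  have [imb0 vimb0 freq0 const_price] := equilibrium_balanced eq_x.
  split=> // i; last 2 first.
  - by have := vimb0 i; rewrite /virtual_imbalance; lra.
  - by have := imb0 i; rewrite /imbalance freq0; lra.
  split.
  - have := subgradient_Demand x i; rewrite eq_x /local_freq /local_price imb0 vimb0 freq0.
    by congr subgradient; ring.
  - by have := subgradient_Eta x i; rewrite eq_x addr0 subr0.
have imb0 i : imbalance x i = 0 by rewrite /imbalance freq0 divE; ring.
have vimb0 i : virtual_imbalance x i = 0 by rewrite /virtual_imbalance lapE; ring.
have local_freq0 i : local_freq x i = 0 by rewrite /local_freq imb0 freq0 addr0.
have priceE i : local_price x i = x (Price i) by rewrite /local_price vimb0 addr0.
case=> i.
- have [_ sgf2] := opt i; apply/eqP; rewrite subr_eq0; apply/eqP; apply: prox_eq.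
  by move: sgf2; congr subgradient; rewrite /=; ring.
- have [sgitv _] := opt i; rewrite vector_field_Demand; apply/eqP; rewrite subr_eq0.
  apply/eqP; apply: prox_eq; move: sgitv; rewrite local_freq0 priceE.
  by congr subgradient; ring.
- rewrite vector_field_Angle /laplacian /divergence !big1 ?subrr // => j _;
  by rewrite !priceE (const_price i j) subrr mulr0.
- by move=> j; rewrite vector_field_Flow /on_lines !local_freq0 subrr if_same.
- by rewrite vector_field_Freq imb0 mul0r.
- by rewrite vector_field_Price vimb0 mul0r.
Qed.

Lemma equilibrium_exists (c th : 'I_n -> R) :
  (forall i, lo i <= c i <= hi i) -> (forall i, u2 E B Pin c th i = 0) ->
  exists x, equilibrium x.
Proof.
move=> cin c_balanced.
have [m [d [s [opt sum_d]]]] :=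
  balanced_node_optimum beta_gt0 f0_derivable f0_strongly_convex f2_convex cin.
have [|ths thsE] := laplacian_surjective E_connected B_gt0 (b := fun i => Pin i - d i).
  rewrite sumrB sum_d -sumrB -[RHS](sum_divergence E (fun i j => B i j * (th i - th j))).
  by apply: eq_bigr => i _; have := c_balanced i; rewrite u2E /laplacian; lra.
exists (fun k => match k with
  | Eta i => - s i / kappa | Demand i => d i | Angle i => ths i
  | Flow i j => B i j * (ths i - ths j) | Freq i => 0 | Price i => m end).
apply/equilibriumP; split=> // i.
have -> : - (kappa * (- s i / kappa)) = s i.
  by have /andP[k0 _] := kappa01; field; rewrite gt_eqF.
exact: opt.
Qed.

Lemma rolc_cost_fin (d w : 'I_n -> R) : (forall i, lo i <= d i <= hi i) ->
  rolc_cost f0 f2 lo hi D d w =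
  (\sum_i (f0 i (d i) + f2 i (d i) + D i / 2 * w i ^+ 2))%:E.
Proof.
move=> din; rewrite /rolc_cost -sumEFin; apply: eq_bigr => i _.
by rewrite /indicator_itv din adde0 -!EFinD.
Qed.

Lemma rolc_cost_infty (d w : 'I_n -> R) i : ~~ (lo i <= d i <= hi i) ->
  rolc_cost f0 f2 lo hi D d w = +oo%E.
Proof.
move=> dout; apply/esum_eqyP => [j _|]; first by rewrite /indicator_itv; case: ifP.
by exists i; rewrite mem_index_enum /indicator_itv (negbTE dout).
Qed.

(* The common price is the multiplier of the power balance. *)
Lemma equilibrium_optimal x : equilibrium x ->
  rolc_optimal E B Pin D lo hi f0 f2 (x \o @Demand n) (x \o @Angle n) (x \o @Freq n) (flow x).
Proof.
move=> /[dup] /equilibrium_balanced[imb0 vimb0 _ _] /equilibriumP[opt const_price freq0 lapE _].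
have din i : lo i <= x (Demand i) <= hi i by have [/subgradient_itv[]] := opt i.
split; first by move=> i; rewrite u1_imbalance u2_virtual_imbalance.
split=> [|d' th' w' P' feasible]; first by rewrite rolc_cost_fin // ltry.
have [/forallP d'in|/forallPn[i]] := boolP [forall i, lo i <= d' i <= hi i]; last first.
  by move=> /rolc_cost_infty ->; rewrite leey.
have sum_d' : \sum_i (d' i - x (Demand i)) = 0.
  transitivity (\sum_i (laplacian E B (x \o @Angle n) i - laplacian E B th' i)).
    by apply: eq_bigr => i _; have [_] := feasible i; rewrite u2E lapE; lra.
  by rewrite sumrB !sum_divergence subrr.
have price_gap0 : \sum_i x (Price i) * (d' i - x (Demand i)) = 0.
  have [i0 _|no_bus] := pickP 'I_n; last by rewrite big1 // => i; have := no_bus i.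
  by under eq_bigr => i _ do rewrite (const_price i i0); rewrite -mulr_sumr sum_d' mulr0.
rewrite !rolc_cost_fin // lee_fin -subr_ge0 -sumrB -[leLHS]price_gap0.
apply: ler_sum => i _; have [/subgradient_itv[_ /(_ _ (d'in i)) above]] := opt i.
move=> /subgradient_EFin/(_ (d' i)) below.
have := strongly_convex_tangent (d' i) (f0_strongly_convex i) (@f0_derivable i (x (Demand i))).
have : 0 <= beta / 2 * (d' i - x (Demand i)) ^+ 2.
  by rewrite mulr_ge0 ?sqr_ge0 // divr_ge0 // ltW.
have : 0 <= D i / 2 * w' i ^+ 2 by rewrite mulr_ge0 ?sqr_ge0 // divr_ge0 // ltW.
by rewrite /= freq0; lra.
Qed.

(** * The Lyapunov function *)

Definition bregman (f : R -> R) (u v : R) : R := f u - f v - derive1 f v * (u - v).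

Definition gap xs x : state := fun k => x k - xs k.

Definition price_gap xs x i : R := local_price x i - xs (Price i).

Definition cost_energy xs x i : R :=
  gap xs x (Demand i) ^+ 2 / 2 + bregman (f0 i) (x (Demand i)) (xs (Demand i))
  + kappa * gap xs x (Eta i) ^+ 2 / 2 - kappa * (gap xs x (Eta i) * gap xs x (Demand i)).

Definition price_energy xs x i : R :=
  price_gap xs x i ^+ 2 / 2 + gap xs x (Price i) ^+ 2 / 2 + gap xs x (Angle i) ^+ 2 / 2.

(* The weight [3 / 2] cancels the cross terms between [x (Freq i)] and its
   derivative in [sum_freq_rate]. *)
Definition freq_energy x i : R :=
  local_freq x i ^+ 2 / 2 + x (Freq i) ^+ 2 / 2 + 3 / 2 * (D i * x (Freq i) ^+ 2).

Definition flow_energy xs x : R := \sum_i \sum_j gap xs x (Flow i j) ^+ 2 / 2.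

Definition lyapunov xs x : R :=
  \sum_i (cost_energy xs x i + price_energy xs x i + freq_energy x i) + flow_energy xs x.

(* Differentials of the energies at [x] in the direction [y]. *)
Definition cost_rate xs x y i : R :=
  (gap xs x (Demand i) + derive1 (f0 i) (x (Demand i)) - derive1 (f0 i) (xs (Demand i))
    - kappa * gap xs x (Eta i)) * y (Demand i)
  + kappa * (gap xs x (Eta i) - gap xs x (Demand i)) * y (Eta i).

Definition price_rate xs x y i : R :=
  price_gap xs x i * (y (Price i) - y (Demand i) - laplacian E B (y \o @Angle n) i)
  + gap xs x (Price i) * y (Price i) + gap xs x (Angle i) * y (Angle i).

Definition freq_rate x y i : R :=
  local_freq x i * (y (Freq i) - y (Demand i) - D i * y (Freq i) - divergence E (flow y) i)
  + x (Freq i) * y (Freq i) + 3 * (D i * (x (Freq i) * y (Freq i))).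

Definition flow_rate xs x y : R := \sum_i \sum_j gap xs x (Flow i j) * y (Flow i j).

Definition lyapunov_rate xs x y : R :=
  \sum_i (cost_rate xs x y i + price_rate xs x y i + freq_rate x y i) + flow_rate xs x y.

Lemma is_derive_divergence (P : 'I_n -> 'I_n -> R -> R) (dP : 'I_n -> 'I_n -> R) (t : R) i :
  (forall i j, is_derive t 1 (P i j) (dP i j)) ->
  is_derive t 1 (fun s => divergence E (fun i j => P i j s) i) (divergence E dP i).
Proof.
by move=> dPt; apply: is_deriveB; [apply: (@is_derive_bigsum _ _ _ _ (P i))|
  apply: (@is_derive_bigsum _ _ _ _ (P^~ i))].
Qed.

Section chain_rule.
Variables (X : R -> state) (t : R) (y : state).
Hypothesis dX : forall k, is_derive t 1 (fun s => X s k) (y k).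

Lemma is_derive_local_freq i : is_derive t 1 (fun s => local_freq (X s) i)
  (y (Freq i) - y (Demand i) - D i * y (Freq i) - divergence E (flow y) i).
Proof.
have ddiv := is_derive_divergence (P := fun i j s => X s (Flow i j)) i
  (fun i j => dX (Flow i j)).
rewrite /local_freq /imbalance.
by apply: is_derive_eq; rewrite /GRing.scale /=; ring.
Qed.

Lemma is_derive_local_price i : is_derive t 1 (fun s => local_price (X s) i)
  (y (Price i) - y (Demand i) - laplacian E B (y \o @Angle n) i).
Proof.
have dline j k : is_derive t 1 (fun s => B j k * (X s (Angle j) - X s (Angle k)))
    (B j k * (y (Angle j) - y (Angle k))).
  by apply: is_derive_eq; rewrite /GRing.scale /=; ring.
have dlap : is_derive t 1 (fun s => laplacian E B (X s \o @Angle n) i)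
    (laplacian E B (y \o @Angle n) i) := is_derive_divergence i dline.
rewrite /local_price /virtual_imbalance.
by apply: is_derive_eq; rewrite /GRing.scale /=; ring.
Qed.

Lemma is_derive_cost_energy xs i :
  is_derive t 1 (fun s => cost_energy xs (X s) i) (cost_rate xs (X t) y i).
Proof.
have df0 : is_derive (X t (Demand i)) 1 (f0 i) (derive1 (f0 i) (X t (Demand i))).
  by rewrite derive1E; apply: derivableP.
have df0X := is_derive1_comp df0 (dX (Demand i)).
rewrite /cost_energy /gap /bregman; apply: is_derive_eq.
by rewrite /cost_rate /gap /GRing.scale /=; field.
Qed.

Lemma is_derive_price_energy xs i :
  is_derive t 1 (fun s => price_energy xs (X s) i) (price_rate xs (X t) y i).
Proof.
have dprice := is_derive_local_price i.
rewrite /price_energy /price_gap /gap; apply: is_derive_eq.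
by rewrite /price_rate /price_gap /gap /GRing.scale /=; field.
Qed.

Lemma is_derive_freq_energy i :
  is_derive t 1 (fun s => freq_energy (X s) i) (freq_rate (X t) y i).
Proof.
have dfreq := is_derive_local_freq i; apply: is_derive_eq.
by rewrite /freq_rate /GRing.scale /=; field.
Qed.

Lemma is_derive_flow_energy xs :
  is_derive t 1 (fun s => flow_energy xs (X s)) (flow_rate xs (X t) y).
Proof.
apply: (@is_derive_bigsum _ _ _ _ (fun i s => \sum_j gap xs (X s) (Flow i j) ^+ 2 / 2)) => i _.
apply: (@is_derive_bigsum _ _ _ _ (fun j s => gap xs (X s) (Flow i j) ^+ 2 / 2)) => j _.
by rewrite /gap; apply: is_derive_eq; rewrite /GRing.scale /=; field.
Qed.

Lemma is_derive_lyapunov xs :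
  is_derive t 1 (fun s => lyapunov xs (X s)) (lyapunov_rate xs (X t) y).
Proof.
apply: is_deriveD; last exact: is_derive_flow_energy.
apply: (@is_derive_bigsum _ _ _ _ (fun i s =>
  cost_energy xs (X s) i + price_energy xs (X s) i + freq_energy (X s) i)) => i _.
apply: is_deriveD; last exact: is_derive_freq_energy.
by apply: is_deriveD; [exact: is_derive_cost_energy|exact: is_derive_price_energy].
Qed.

End chain_rule.

Lemma laplacian_angle_gap xs x i : equilibrium xs ->
  laplacian E B (gap xs x \o @Angle n) i =
  - gap xs x (Demand i) - 2 * vector_field x (Price i).
Proof.
move=> /equilibriumP[_ _ _ lapE _]; rewrite vector_field_Price /virtual_imbalance /gap.
rewrite (laplacianB E B (x \o @Angle n) (xs \o @Angle n)).
by have := lapE i; lra.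
Qed.

Lemma divergence_flow_gap xs x i : equilibrium xs ->
  divergence E (flow (gap xs x)) i =
  - gap xs x (Demand i) - D i * x (Freq i) - 2 * vector_field x (Freq i).
Proof.
move=> /equilibriumP[_ _ _ _ divE].
rewrite (divergenceB E (flow x) (flow xs)) vector_field_Freq /imbalance divE /gap.
by field.
Qed.

Lemma laplacian_price_gap xs x i : equilibrium xs ->
  laplacian E B (price_gap xs x) i = vector_field x (Angle i).
Proof.
move=> /equilibriumP[_ const_price _ _ _]; rewrite vector_field_Angle.
by apply: eq_divergence => j k _; rewrite /price_gap (const_price j k); ring.
Qed.

Lemma sum_flow_work (P : 'I_n -> 'I_n -> R) x :
  \sum_i \sum_j P i j * vector_field x (Flow i j) =
  \sum_i local_freq x i * divergence E P i.
Proof.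
rewrite sum_mul_divergence; apply: eq_bigr => i _; rewrite [RHS]big_mkcond.
apply: eq_bigr => j _; rewrite vector_field_Flow /on_lines.
by case: ifP => _; rewrite ?mulr0.
Qed.

(* The Laplacian is symmetric, so the angle terms cancel against price terms. *)
Lemma sum_price_rate xs x : equilibrium xs ->
  \sum_i price_rate xs x (vector_field x) i =
  - \sum_i (price_gap xs x i * (gap xs x (Demand i) + vector_field x (Demand i))
            + 2 * vector_field x (Price i) ^+ 2 + vector_field x (Angle i) ^+ 2).
Proof.
move=> eq_xs; set F := vector_field x.
have lap_price i : laplacian E B (price_gap xs x) i = F (Angle i) by exact: laplacian_price_gap.
have angle_work : \sum_i gap xs x (Angle i) * F (Angle i) =
    \sum_i price_gap xs x i * (- gap xs x (Demand i) - 2 * F (Price i)).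
  under eq_bigr do rewrite -lap_price; rewrite (laplacian_sym E B (gap xs x \o @Angle n)).
  by apply: eq_bigr => i _; rewrite laplacian_angle_gap.
have price_work : \sum_i price_gap xs x i * laplacian E B (F \o @Angle n) i =
    \sum_i F (Angle i) ^+ 2.
  by rewrite laplacian_sym; apply: eq_bigr => i _; rewrite lap_price expr2.
transitivity (\sum_i (price_gap xs x i * (F (Price i) - F (Demand i))
      + gap xs x (Price i) * F (Price i))
    - \sum_i price_gap xs x i * laplacian E B (F \o @Angle n) i
    + \sum_i gap xs x (Angle i) * F (Angle i)).
  by rewrite -sumrB -big_split; apply: eq_bigr => i _; rewrite /price_rate /=; ring.
rewrite angle_work price_work -sumrB -big_split -sumrN; apply: eq_bigr => i _.
by rewrite /price_gap /gap /local_price /F vector_field_Price /=; field.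
Qed.

Lemma sum_freq_rate xs x : equilibrium xs ->
  \sum_i freq_rate x (vector_field x) i + flow_rate xs x (vector_field x) =
  - \sum_i (local_freq x i * (gap xs x (Demand i) + vector_field x (Demand i))
            + 2 * vector_field x (Freq i) ^+ 2
            + D i * (x (Freq i) ^+ 2 + 2 * vector_field x (Freq i) ^+ 2))
  - \sum_i \sum_j vector_field x (Flow i j) ^+ 2.
Proof.
move=> eq_xs; rewrite /flow_rate (sum_flow_work (flow (gap xs x))); set F := vector_field x.
have flow_work : \sum_i local_freq x i * divergence E (flow F) i =
    \sum_i \sum_j F (Flow i j) ^+ 2.
  by rewrite -sum_flow_work; apply: eq_bigr => i _; apply: eq_bigr => j _; rewrite expr2.
rewrite -flow_work -sumrN -sumrB -big_split; apply: eq_bigr => i _.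
by rewrite /= divergence_flow_gap // /freq_rate -/F /local_freq /F vector_field_Freq; field.
Qed.

(* Monotonicity of the two subdifferentials, between the proximal steps at [x] and
   the equilibrium. *)
Lemma cost_rate_le xs x i : equilibrium xs ->
  cost_rate xs x (vector_field x) i <=
  (local_freq x i + price_gap xs x i) * (gap xs x (Demand i) + vector_field x (Demand i))
  - (1 - kappa) / 2 * (vector_field x (Demand i) ^+ 2 + vector_field x (Eta i) ^+ 2).
Proof.
move=> /equilibriumP[opt _ _ _ _]; have [demand_opt eta_opt] := opt i.
have := subgradient_monotone (subgradient_Eta x i) eta_opt.
have := subgradient_monotone (subgradient_Demand x i) demand_opt.
have := strongly_convex_monotone (f0_strongly_convex i)
  (@f0_derivable i (x (Demand i))) (@f0_derivable i (xs (Demand i))).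
rewrite /cost_rate /price_gap /gap.
move: (vector_field x (Demand i)) (vector_field x (Eta i)) => fd fe.
set d := x (Demand i) - xs (Demand i).
have -> : x (Demand i) + fd - xs (Demand i) = d + fd by rewrite /d; ring.
have -> : x (Demand i) + fe - xs (Demand i) = d + fe by rewrite /d; ring.
have /andP[k0 k1] := kappa01.
have d_le : d ^+ 2 <= beta * d ^+ 2 by rewrite ler_peMl ?sqr_ge0 // ltW.
have de_ge0 : 0 <= (1 + kappa) / 2 * (d + fe) ^+ 2 by rewrite mulr_ge0 ?sqr_ge0 //; lra.
have d_ge0 : 0 <= (1 - kappa) / 2 * d ^+ 2 by rewrite mulr_ge0 ?sqr_ge0 //; lra.
have fd_ge0 : 0 <= (1 + kappa) / 2 * fd ^+ 2 by rewrite mulr_ge0 ?sqr_ge0 //; lra.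
lra.
Qed.

Definition node_sqnorm x i : R :=
  x (Eta i) ^+ 2 + x (Demand i) ^+ 2 + x (Angle i) ^+ 2 + x (Freq i) ^+ 2 + x (Price i) ^+ 2.

Definition sqnorm x : R := \sum_i node_sqnorm x i + \sum_i \sum_j x (Flow i j) ^+ 2.

Definition gain : R := kappa * (1 - kappa) / 4.

Lemma gain_gt0 : 0 < gain.
Proof. by have /andP[k0 k1] := kappa01; rewrite divr_gt0 ?mulr_gt0 ?subr_gt0. Qed.

Lemma gain_bounds : gain <= kappa / 4 /\ gain <= (1 - kappa) / 2.
Proof. by have /andP[k0 k1] := kappa01; rewrite /gain; split; nra. Qed.

Lemma lyapunov_rate_le xs x : equilibrium xs ->
  lyapunov_rate xs x (vector_field x) <= - (gain * sqnorm (vector_field x)).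
Proof.
move=> eq_xs; set F := vector_field x; have /andP[k0 k1] := kappa01.
have [gain_le_kappa gain_le_half] := gain_bounds.
have -> : lyapunov_rate xs x F = \sum_i cost_rate xs x F i + \sum_i price_rate xs x F i
    + (\sum_i freq_rate x F i + flow_rate xs x F).
  by rewrite /lyapunov_rate !big_split /=; ring.
rewrite sum_price_rate // sum_freq_rate // /sqnorm -!sumrN -!big_split mulr_sumr -sumrN /=.
apply: ler_sum => i _; apply: le_trans (lerD (lerD (cost_rate_le x i eq_xs) (lexx _)) (lexx _)) _.
have gain_le1 : gain <= 1 by lra.
have flow_le : gain * \sum_j F (Flow i j) ^+ 2 <= \sum_j F (Flow i j) ^+ 2.
  by rewrite ler_piMl // sumr_ge0 // => j _; exact: sqr_ge0.
have damping_ge0 : 0 <= D i * (x (Freq i) ^+ 2 + 2 * F (Freq i) ^+ 2).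
  apply: mulr_ge0; first exact: ltW.
  by have := (sqr_ge0 (x (Freq i)), sqr_ge0 (F (Freq i))) => -[]; lra.
have := ler_mul_sqr gain_le_half (F (Eta i)); have := ler_mul_sqr gain_le_half (F (Demand i)).
have := ler_mul_sqr gain_le1 (F (Angle i)); have := ler_mul_sqr gain_le1 (F (Freq i)).
have := ler_mul_sqr gain_le1 (F (Price i)).
by have := (sqr_ge0 (F (Freq i)), sqr_ge0 (F (Price i))) => -[]; rewrite /node_sqnorm -/F; lra.
Qed.

Lemma node_sqnorm_ge0 x i : 0 <= node_sqnorm x i.
Proof. by rewrite !addr_ge0 ?sqr_ge0. Qed.

Lemma flow_sqnorm_ge0 x i : 0 <= \sum_j x (Flow i j) ^+ 2.
Proof. by apply: sumr_ge0 => j _; exact: sqr_ge0. Qed.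

Lemma sqnorm_ge0 x : 0 <= sqnorm x.
Proof.
by rewrite addr_ge0 // sumr_ge0 // => i _; [exact: node_sqnorm_ge0|exact: flow_sqnorm_ge0].
Qed.

Lemma sqr_le_sqnorm x k : x k ^+ 2 <= sqnorm x.
Proof.
have node_le i : node_sqnorm x i <= sqnorm x.
  rewrite /sqnorm (bigD1 i) //= -addrA lerDl addr_ge0 // sumr_ge0 // => j _.
    exact: node_sqnorm_ge0.
  exact: flow_sqnorm_ge0.
have line_le i j : x (Flow i j) ^+ 2 <= sqnorm x.
  apply: ler_wpDl; first by apply: sumr_ge0 => l _; exact: node_sqnorm_ge0.
  rewrite (bigD1 i) //= (bigD1 j) //= -addrA lerDl addr_ge0 // sumr_ge0 // => l _.
    exact: sqr_ge0.
  exact: flow_sqnorm_ge0.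
case: k => [i|i|i|i j|i|i]; first [exact: line_le|apply: le_trans (node_le i)].
all: have := (sqr_ge0 (x (Eta i)), sqr_ge0 (x (Demand i)), sqr_ge0 (x (Angle i)),
  sqr_ge0 (x (Freq i)), sqr_ge0 (x (Price i))) => -[[[[]]]]; rewrite /node_sqnorm; lra.
Qed.

Lemma lyapunov_ge xs x : equilibrium xs -> gain * sqnorm (gap xs x) <= lyapunov xs x.
Proof.
move=> /equilibriumP[_ _ freq0 _ _]; have /andP[k0 k1] := kappa01.
have [gain_le_kappa gain_le_half] := gain_bounds.
have gain_le2 : gain <= 1 / 2 by lra.
have gain_le_damping : gain <= 1 - kappa by lra.
rewrite /sqnorm mulrDr lerD // mulr_sumr; apply: ler_sum => i _; last first.
  rewrite mulr_sumr; apply: ler_sum => j _.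
  by have := ler_mul_sqr gain_le2 (gap xs x (Flow i j)); lra.
have freq_gap : gap xs x (Freq i) = x (Freq i) by rewrite /gap freq0 subr0.
rewrite /node_sqnorm freq_gap /cost_energy /price_energy /freq_energy.
set e := gap xs x (Eta i); set d := gap xs x (Demand i).
have breg : beta / 2 * d ^+ 2 <= bregman (f0 i) (x (Demand i)) (xs (Demand i)).
  have := strongly_convex_tangent (x (Demand i)) (f0_strongly_convex i)
    (@f0_derivable i (xs (Demand i))).
  by rewrite /bregman /d /gap; lra.
have beta_sqr : d ^+ 2 <= beta * d ^+ 2 by rewrite ler_peMl ?sqr_ge0 // ltW.
have young : 0 <= kappa * (e / 2 - d) ^+ 2 by rewrite mulr_ge0 ?sqr_ge0 // ltW.
have damping : 0 <= D i * x (Freq i) ^+ 2 by rewrite mulr_ge0 ?sqr_ge0 // ltW.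
have := (ler_mul_sqr gain_le_kappa e, ler_mul_sqr gain_le_damping d,
  ler_mul_sqr gain_le2 (x (Freq i)), ler_mul_sqr gain_le2 (gap xs x (Price i)),
  ler_mul_sqr gain_le2 (gap xs x (Angle i))) => -[[[[? ?] ?] ?] ?].
have := (sqr_ge0 (price_gap xs x i), sqr_ge0 (local_freq x i)) => -[? ?].
lra.
Qed.

Lemma lyapunov_ge0 xs x : equilibrium xs -> 0 <= lyapunov xs x.
Proof.
by move=> /(lyapunov_ge x); apply: le_trans; rewrite mulr_ge0 ?sqnorm_ge0 // ltW ?gain_gt0.
Qed.

Lemma lyapunov_refl xs : equilibrium xs -> lyapunov xs xs = 0.
Proof.
move=> /equilibrium_balanced[imb0 vimb0 freq0 _].
rewrite /lyapunov /flow_energy !big1 ?addr0 // => i _.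
  by rewrite big1 // => j _; rewrite /gap subrr; ring.
rewrite /cost_energy /price_energy /freq_energy /bregman /price_gap /gap.
by rewrite /local_freq /local_price imb0 vimb0 freq0; ring.
Qed.

Definition dissipation x : R := gain * sqnorm (vector_field x).

Lemma dissipation_ge0 x : 0 <= dissipation x.
Proof. by rewrite mulr_ge0 ?sqnorm_ge0 // ltW ?gain_gt0. Qed.

Lemma dissipation_eq0 x : dissipation x = 0 <-> equilibrium x.
Proof.
split=> [/eqP|eq_x].
  rewrite mulf_eq0 gt_eqF ?gain_gt0 //= => /eqP sqn0 k.
  by apply/eqP; rewrite -sqrf_eq0 eq_le sqr_ge0 andbT -sqn0 sqr_le_sqnorm.
rewrite /dissipation /sqnorm /node_sqnorm !big1 ?addr0 ?mulr0 // => i _.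
  by rewrite big1 // => j _; rewrite eq_x expr0n.
by rewrite !eq_x expr0n /= !addr0.
Qed.

Lemma lyapunov_coercive xs x k : dissipation xs = 0 ->
  gain * (x k - xs k) ^+ 2 <= lyapunov xs x.
Proof.
move=> /dissipation_eq0/(lyapunov_ge x); apply: le_trans.
by rewrite ler_pM2l ?gain_gt0 //; exact: (sqr_le_sqnorm (gap xs x)).
Qed.

(** * Continuity along convergent states *)

Section continuity.
Context {T : Type} (F : set_system T) (FF : Filter F) (X : T -> state) (x : state).
Hypothesis X_cvg : forall k, X t k @[t --> F] --> x k.

Local Ltac solve_cvg := repeat
  lazymatch goal with
  | |- _ --> (_ - _) => apply: cvgB
  | |- _ --> (_ + _) => apply: cvgD
  | |- _ --> (_ * _) => apply: cvgM
  | |- _ --> (_ ^+ 2) => apply: cvg_sqr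
  | |- _ => first [simple apply X_cvg | assumption | exact: cvg_cst]
  end.

Lemma cvg_divergence (P : T -> 'I_n -> 'I_n -> R) (Q : 'I_n -> 'I_n -> R) i :
  (forall i j, P t i j @[t --> F] --> Q i j) ->
  divergence E (P t) i @[t --> F] --> divergence E Q i.
Proof. by move=> PQ; apply: cvgB; apply: cvg_bigsum => j _; exact: PQ. Qed.

Lemma cvg_imbalance i : imbalance (X t) i @[t --> F] --> imbalance x i.
Proof.
have div_cvg : divergence E (flow (X t)) i @[t --> F] --> divergence E (flow x) i.
  by apply: cvg_divergence => j k; exact: X_cvg.
by rewrite /imbalance; solve_cvg.
Qed.

Lemma cvg_virtual_imbalance i : virtual_imbalance (X t) i @[t --> F] --> virtual_imbalance x i.
Proof.
have lap_cvg : laplacian E B (X t \o @Angle n) i @[t --> F] --> laplacian E B (x \o @Angle n) i.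
  by apply: cvg_divergence => j k; apply: cvgM; [exact: cvg_cst|apply: cvgB; exact: X_cvg].
by rewrite /virtual_imbalance; solve_cvg.
Qed.

Lemma cvg_local_freq i : local_freq (X t) i @[t --> F] --> local_freq x i.
Proof. by apply: cvgD; [exact: X_cvg|exact: cvg_imbalance]. Qed.

Lemma cvg_local_price i : local_price (X t) i @[t --> F] --> local_price x i.
Proof. by apply: cvgD; [exact: X_cvg|exact: cvg_virtual_imbalance]. Qed.

Lemma cvg_vector_field k : vector_field (X t) k @[t --> F] --> vector_field x k.
Proof.
case: k => [i|i|i|i j|i|i].
- rewrite /vector_field /rhs_eta /=; apply: cvgB; last exact: X_cvg.
  apply: continuous_cvg; first exact: prox_continuous (convex_proximable (f2_convex i)) _.
  by solve_cvg.
- under eq_cvg do rewrite vector_field_Demand; rewrite vector_field_Demand.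
  apply: cvgB; last exact: X_cvg.
  apply: continuous_cvg; first exact: prox_continuous (itv_proximable (lo_le_hi i)) _.
  have df0_cvg : derive1 (f0 i) (X t (Demand i)) @[t --> F] --> derive1 (f0 i) (x (Demand i)).
    apply: continuous_cvg; last exact: X_cvg.
    exact: strongly_convex_derive1_continuous (ltW beta_gt0) (f0_strongly_convex i) _ _.
  have freq_cvg := @cvg_local_freq i; have price_cvg := @cvg_local_price i.
  by solve_cvg.
- under eq_cvg do rewrite vector_field_Angle; rewrite vector_field_Angle.
  apply: cvg_divergence => j k.
  by apply: cvgM; [exact: cvg_cst|apply: cvgB; exact: cvg_local_price].
- under eq_cvg do rewrite vector_field_Flow; rewrite vector_field_Flow /on_lines.
  by case: ifP => _; [apply: cvgB; exact: cvg_local_freq|exact: cvg_cst].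
- under eq_cvg do rewrite vector_field_Freq; rewrite vector_field_Freq.
  by apply: cvgM; [exact: cvg_imbalance|exact: cvg_cst].
- under eq_cvg do rewrite vector_field_Price; rewrite vector_field_Price.
  by apply: cvgM; [exact: cvg_virtual_imbalance|exact: cvg_cst].
Qed.

Lemma cvg_dissipation : dissipation (X t) @[t --> F] --> dissipation x.
Proof.
have sqr_cvg k : vector_field (X t) k ^+ 2 @[t --> F] --> vector_field x k ^+ 2.
  by apply: cvg_sqr; exact: cvg_vector_field.
apply: cvgM; first exact: cvg_cst.
apply: cvgD; last by apply: cvg_bigsum => i _; apply: cvg_bigsum => j _.
by apply: cvg_bigsum => i _; do 4 (apply: cvgD; last exact: sqr_cvg).
Qed.

Lemma cvg_lyapunov xs : lyapunov xs (X t) @[t --> F] --> lyapunov xs x.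
Proof.
apply: cvgD; apply: cvg_bigsum => i _; last first.
  by apply: cvg_bigsum => j _; rewrite /gap; solve_cvg.
have freq_cvg := @cvg_local_freq i; have price_cvg := @cvg_local_price i.
have f0_cvg : f0 i (X t (Demand i)) @[t --> F] --> f0 i (x (Demand i)).
  by apply: continuous_cvg; [exact: derivable1_continuous|exact: X_cvg].
by rewrite /cost_energy /price_energy /freq_energy /bregman /price_gap /gap; solve_cvg.
Qed.

End continuity.

(** * Trajectories *)

Lemma cvg_coord x k : y k @[y --> x] --> x k.
Proof. exact: (@proj_continuous (coord n) (fun=> R)). Qed.

Section solution.
Variable X : R -> state.
Hypothesis X_solution : forall (t : R) k, 0 < t ->
  is_derive t 1 (fun s => X s k) (vector_field (X t) k).

Lemma solution_lyapunov_family : lyapunov_family X lyapunov dissipation.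
Proof.
have dV xs (t : R) (t0 : 0 < t) := is_derive_lyapunov (fun k => @X_solution t k t0) xs.
split.
- by move=> x; exact: (@cvg_dissipation _ (nbhs x) _ id x (@cvg_coord x)).
- exact: dissipation_ge0.
- by move=> y x /dissipation_eq0; exact: lyapunov_ge0.
- move=> y /dissipation_eq0/lyapunov_refl <-.
  exact: (@cvg_lyapunov _ (nbhs y) _ id y (@cvg_coord y)).
- by move=> y t _ t0; have dVt := dV y t t0; exact: ex_derive.
- move=> y t /dissipation_eq0 eq_y t0; have dVt := dV y t t0.
  by rewrite derive1E derive_val; exact: lyapunov_rate_le.
Qed.

Lemma solution_bounded xs (t0 : R) : equilibrium xs -> 0 < t0 ->
  exists r, forall t k, t0 <= t -> `|X t k - xs k| <= r.
Proof.
move=> /dissipation_eq0 xs0 t00.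
exact: (coercive_lyapunov_bounded solution_lyapunov_family gain_gt0 lyapunov_coercive xs0 t00).
Qed.

Lemma solution_cvg xs : equilibrium xs ->
  exists2 y, equilibrium y & forall k, X t k @[t --> +oo] --> y k.
Proof.
move=> /dissipation_eq0/(coercive_lyapunov_cvg solution_lyapunov_family gain_gt0
  lyapunov_coercive)[y /dissipation_eq0 eq_y X_cvg].
by exists y.
Qed.

End solution.

Lemma equilibrium_dppd x : equilibrium x ->
  dppd_equilibrium E B Pin D lo hi f0 f2 kappa (x \o @Eta n) (x \o @Demand n)
    (x \o @Angle n) (flow x) (x \o @Freq n) (x \o @Price n).
Proof.
move=> eq_x; split=> [i|]; first exact: (eq_x (Eta i)).
split=> [i|]; first exact: (eq_x (Demand i)).
split=> [i|]; first exact: (eq_x (Angle i)).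
split=> [i j Eij|]; first by have := eq_x (Flow i j); rewrite /vector_field /on_lines Eij.
by split=> i; [exact: (eq_x (Freq i))|exact: (eq_x (Price i))].
Qed.

Section dppd_trajectory.
Variables (eta d th : 'I_n -> R -> R) (P : 'I_n -> 'I_n -> R -> R) (w lam mu : 'I_n -> R -> R).
Hypothesis traj : dppd_trajectory E B Pin D lo hi f0 f2 kappa eta d th P w lam mu.

Definition trajectory_state (t : R) : state := fun k =>
  match k with
  | Eta i => eta i t | Demand i => d i t | Angle i => th i t
  | Flow i j => on_lines E (fun i j => P i j t) i j
  | Freq i => lam i t | Price i => mu i t
  end.

Lemma trajectory_state_Flow i j : E i j -> trajectory_state ^~ (Flow i j) = P i j.
Proof. by move=> Eij; apply/funext => t; rewrite /trajectory_state /on_lines Eij. Qed.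

Lemma trajectory_state_continuous k :
  {within `[0, +oo[%classic, continuous (trajectory_state ^~ k)}.
Proof.
have [_ [eta_c [d_c [th_c [P_c [lam_c [mu_c _]]]]]]] := traj.
case: k => [i|i|i|i j|i|i]; [exact: eta_c|exact: d_c|exact: th_c| |exact: lam_c|exact: mu_c].
rewrite /trajectory_state /on_lines.
by case: (boolP (E i j)) => [/P_c //|_] t; exact: cvg_cst.
Qed.

Lemma u1_on_lines (d0 w0 : 'I_n -> R) (P0 : 'I_n -> 'I_n -> R) :
  u1 E Pin D d0 w0 (on_lines E P0) = u1 E Pin D d0 w0 P0.
Proof.
apply/funext => i; rewrite !u1E; congr (_ - _); apply: eq_divergence => j k Ejk.
by rewrite /on_lines Ejk.
Qed.

Lemma trajectory_state_solution (t : R) k : 0 < t ->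
  is_derive t 1 (trajectory_state ^~ k) (vector_field (trajectory_state t) k).
Proof.
have [_ [_ [_ [_ [_ [_ [_ dyn]]]]]]] := traj.
have flowE : flow (trajectory_state t) = on_lines E (fun i j => P i j t) by [].
move=> /dyn[deta [dd [dth [dP [dlam dmu]]]]].
case: k => [i|i|i|i j|i|i]; rewrite /vector_field.
- exact: deta.
- by rewrite /rhs_d flowE u1_on_lines; exact: dd.
- exact: dth.
- rewrite /rhs_P flowE u1_on_lines /trajectory_state /on_lines.
  by case: (boolP (E i j)) => [Eij|_]; [exact: dP|exact: is_derive_cst].
- by rewrite /rhs_lam flowE u1_on_lines; exact: dlam.
- exact: dmu.
Qed.

Lemma demand_invariant : (forall i, lo i <= d i 0 <= hi i) ->
  forall i t, 0 <= t -> lo i <= d i t <= hi i.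
Proof.
move=> d0_in i.
pose target t := d i t - derive1 (f0 i) (d i t) + kappa * eta i t
  + local_freq (trajectory_state t) i + local_price (trajectory_state t) i.
apply: (relaxation_invariant (p := fun t => prox (indicator_itv (lo i) (hi i)) (target t))) => //.
- exact: (@trajectory_state_continuous (Demand i)).
- by move=> t t0; have := trajectory_state_solution (Demand i) t0; rewrite vector_field_Demand.
- by move=> t _; have /subgradient_itv[] := itv_proximable (lo_le_hi i) (target t).
Qed.

Lemma trajectory_bounded xs : equilibrium xs -> forall k, bounded_fwd (trajectory_state ^~ k).
Proof.
move=> eq_xs k; have [r X_bounded] := solution_bounded trajectory_state_solution eq_xs ltr01.
apply: (bounded_fwd_eventually _ ler01 (X_bounded ^~ k)); exact: trajectory_state_continuous.
Qed.

End dppd_trajectory.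

End dppd.

Theorem theorem2 (R : realType) (n : nat) (E : rel 'I_n)
  (B : 'I_n -> 'I_n -> R) (D Pin lo hi : 'I_n -> R)
  (Plo Phi : 'I_n -> 'I_n -> R)
  (f0 f2 : 'I_n -> R -> R) (beta kappa : R)
  (* network *)
  (Hconn : weakly_connected E)
  (HB : forall i j, E i j -> 0 < B i j)
  (HD : forall i, 0 < D i)
  (Hkappa : 0 < kappa < 1)
  (* cost functions *)
  (Hf0d : forall i x, derivable (f0 i) x 1)
  (Hf2cvx : forall i, convex_on_R (f2 i))
  (Hf2lsc : forall i, lower_semicontinuous (fun x => (f2 i x)%:E))
  (* Assumption 1 *)
  (Hbeta : 1 < beta)
  (Hf0sc : forall i, strongly_convex beta (f0 i))
  (* Assumption 2 (Slater) *)
  (Hlim : forall i j, E i j -> Plo i j <= Phi i j)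
  (Hslater : exists (dt tht : 'I_n -> R),
      (forall i, in_relint_itv (lo i) (hi i) (dt i)) /\
      (forall i, u2 E B Pin dt tht i = 0) /\
      (forall i j, E i j -> Plo i j < B i j * (tht i - tht j) < Phi i j))
  (* a trajectory of the DPPD dynamics *)
  (eta d th : 'I_n -> R -> R) (P : 'I_n -> 'I_n -> R -> R)
  (w lam mu : 'I_n -> R -> R)
  (Htraj : dppd_trajectory E B Pin D lo hi f0 f2 kappa eta d th P w lam mu) :
  (* 1) invariance of Omega *)
  ((forall i, lo i <= d i 0 <= hi i) ->
     forall i t, 0 <= t -> lo i <= d i t <= hi i) /\
  (* 2) boundedness *)
  ((forall i, bounded_fwd (eta i)) /\ (forall i, bounded_fwd (d i)) /\
   (forall i, bounded_fwd (th i)) /\ (forall i j, E i j -> bounded_fwd (P i j)) /\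
   (forall i, bounded_fwd (w i)) /\ (forall i, bounded_fwd (mu i))) /\
  (* 3) convergence to an equilibrium whose (d, th, P, w) part is ROLC-optimal *)
  (exists (etas ds ths : 'I_n -> R) (Ps : 'I_n -> 'I_n -> R) (ws mus : 'I_n -> R),
     dppd_equilibrium E B Pin D lo hi f0 f2 kappa etas ds ths Ps ws mus /\
     rolc_optimal E B Pin D lo hi f0 f2 ds ths ws Ps /\
     (forall i, eta i t @[t --> +oo] --> etas i) /\
     (forall i, d i t @[t --> +oo] --> ds i) /\
     (forall i, th i t @[t --> +oo] --> ths i) /\
     (forall i j, E i j -> P i j t @[t --> +oo] --> Ps i j) /\
     (forall i, w i t @[t --> +oo] --> ws i) /\
     (forall i, mu i t @[t --> +oo] --> mus i)).
Proof.
have [c [tht [c_relint [c_balanced _]]]] := Hslater.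
have c_in i : lo i <= c i <= hi i.
  by case: (c_relint i) => [/andP[/ltW -> /ltW ->]|[-> ->]] //; rewrite lexx.
have lo_le_hi i : lo i <= hi i by have /andP[] := c_in i; exact: le_trans.
have [xs eq_xs] := equilibrium_exists Hconn HB HD Hkappa Hf0d Hf2cvx Hbeta Hf0sc lo_le_hi
  c_in c_balanced.
have coord_bounded := trajectory_bounded Hconn HB HD Hkappa Hf0d Hf2cvx Hbeta Hf0sc lo_le_hi
  Htraj eq_xs.
have [y eq_y X_cvg] := solution_cvg Hconn HB HD Hkappa Hf0d Hf2cvx Hbeta Hf0sc lo_le_hi
  (trajectory_state_solution Htraj) eq_xs.
have flowE := @trajectory_state_Flow _ _ E eta d th P lam mu.
have <- : lam = w by apply/funext => i; apply/funext => t; have [->] := Htraj.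
split; first exact: (demand_invariant lo_le_hi Htraj).
split.
  do 5?split; move=> i; [exact: (coord_bounded (Eta i))|exact: (coord_bounded (Demand i))|
    exact: (coord_bounded (Angle i))|by move=> j /flowE <-|
    exact: (coord_bounded (Freq i))|exact: (coord_bounded (Price i))].
exists (y \o @Eta n), (y \o @Demand n), (y \o @Angle n), (flow y), (y \o @Freq n), (y \o @Price n).
split; first exact: equilibrium_dppd.
split; first exact: (equilibrium_optimal Hconn HB HD Hf0d Hf2cvx Hbeta Hf0sc lo_le_hi eq_y).
do 5?split; move=> i; [exact: (X_cvg (Eta i))|exact: (X_cvg (Demand i))|
  exact: (X_cvg (Angle i))|by move=> j /flowE <-; exact: (X_cvg (Flow i j))|
  exact: (X_cvg (Freq i))|exact: (X_cvg (Price i))].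
Qed.
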